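(* Let $q=p^h$ be odd with $p$ prime, let $t<h$ be the largest proper divisor of $h$ (so $h\ge2$), and let $C$ be a linear $(n,k+1,q)$-MDS code over $GF(q)$. Let $S$ be the set of codes consisting of $C$ and all (linear or non-linear) extensions of $C$. If $p^t>3$ and $n>q-p^{h-t}+k-1$ then: (i) all members of $S$ are LE codes; and (ii) there is, up to equivalence, a unique maximal code in $S$.
   Context: An $(n,k,q)$-MDS code over an alphabet $\mathcal A$ of size $q$ is a set of $q^k$ $n$-tuples (words) over $\mathcal A$ such that no two distinct words agree in $k$ or more coordinate positions. It is linear if $\mathcal A=GF(q)$ and the code is a $k$-dimensional subspace of $GF(q)^n$. An $(m,k,q)$-MDS code $C'$ with $m>n$ (over the same alphabet) is an extension of the $(n,k,q)$-MDS code $C$ if deleting some fixed set of $m-n$ coordinate positions from every word of $C'$ yields $C$. An MDS code is maximal if it admits no extensions. Two codes of length $n$ over $\mathcal A$, viewed as matrices whose rows are the words, are equivalent if one is obtained from the other by a sequence of operations of the types: permuting rows; permuting columns; applying a permutation of the alphabet entrywise to a single column. A code is an LE code if it is equivalent to a linear code.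
   Formalization: The formal theorem assumes k ≥ 1, i.e. MDS dimension k+1 ≥ 2; for k = 0 part (ii) is false, since a repetition code can always be extended by repeating a column, so no maximal code exists. *)

(* Defs.v *)
From mathcomp Require Import all_boot all_order all_fingroup all_algebra.

Set Implicit Arguments.
Unset Strict Implicit.
Unset Printing Implicit Defensive.

(* Words are row vectors over an arbitrary finite alphabet.  A code is a set
   of words, so the order of the rows of its matrix is not recorded and
   permuting rows is the identity.  The length is bundled because the
   extensions of a code have varying lengths. *)
Record code (A : finType) :=
  Code { len : nat; words : {set 'rV[A]_len} }.

Arguments Code {A len} words.

Definition is_mds (A : finType) (k : nat) (C : code A) : Prop :=
  #|words C| = (#|A| ^ k)%N /\
  (forall u v : 'rV[A]_(len C), u \in words C -> v \in words C -> u <> v ->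
     #|[set i : 'I_(len C) | u ord0 i == v ord0 i]| < k).

Definition is_linear (F : finFieldType) (k : nat) (C : code F) : Prop :=
  exists2 U : {vspace 'rV[F]_(len C)},
    \dim U = k & words C = [set w | w \in U].

(* The increasing map f lists the coordinates that are kept; the deleted ones
   are the len C' - len C positions outside its image. *)
Definition is_extension (A : finType) (k : nat) (C C' : code A) : Prop :=
  [/\ is_mds k C, is_mds k C', len C < len C' &
      exists f : 'I_(len C) -> 'I_(len C'),
        (forall i j : 'I_(len C), i < j -> f i < f j) /\
        words C = [set colsub f w | w in words C']].

Definition is_maximal (A : finType) (k : nat) (C : code A) : Prop :=
  is_mds k C /\ (forall C' : code A, ~ is_extension k C C').

Definition relabel (A : finType) (n : nat) (j : 'I_n) (s : {perm A})
    (w : 'rV[A]_n) : 'rV[A]_n :=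
  \row_i (if i == j then s (w ord0 i) else w ord0 i).

Inductive equivalent (A : finType) : code A -> code A -> Prop :=
| equivalent_refl (C : code A) : equivalent C C
| equivalent_col_perm (n : nat) (B : {set 'rV[A]_n}) (s : 'S_n) (D : code A) :
    equivalent (Code [set col_perm s w | w in B]) D -> equivalent (Code B) D
| equivalent_relabel (n : nat) (B : {set 'rV[A]_n}) (j : 'I_n) (s : {perm A})
    (D : code A) :
    equivalent (Code [set relabel j s w | w in B]) D -> equivalent (Code B) D.

Definition is_LE (F : finFieldType) (k : nat) (C : code F) : Prop :=
  exists2 L : code F, is_linear k L & equivalent C L.

Definition self_or_extension (A : finType) (k : nat) (C D : code A) : Prop :=
  D = C \/ is_extension k C D.

Definition largest_proper_divisor (t h : nat) : Prop :=
  [/\ t %| h, t < h & forall d : nat, d %| h -> d < h -> d <= t].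

(* Main.v *)
Require Import Defs.
From mathcomp Require Import all_boot all_order all_fingroup all_algebra.
From mathcomp Require Import finfield zify ring.

Set Implicit Arguments.
Unset Strict Implicit.
Unset Printing Implicit Defensive.

Import GRing.Theory.

(** The words of [C] form a space [U] of dimension [k + 1] over [F], on which each
coordinate is a linear functional; the MDS property says that a nonzero word is
killed by at most [k] coordinates, that is, the coordinates form an arc of the
dual projective space.  A further column of an extension is a mere function
[g : U -> F] such that two distinct words with the same value of [g] agree in
fewer than [k] coordinates.  The theorem follows from two facts.

Every such [g] is a relabelled linear functional ([all_columns_periodic]).  When
[U] is a plane, a level set of [g] is the graph of a function [F -> F], and no
chord of this graph has a slope that belongs to one of the coordinates; so the
function has at most [p ^ (h - t)] slopes, and [few_slopes_affine] makes it
affine.  This is the part of the theorem of Blokhuis, Ball, Brouwer, Storme,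
Szonyi and Ball on slopes of functions that is relevant here, and its proof goes
as follows.  The Redei polynomial [prod_x (X - (f x - x Y))] specializes to
[X^q - X] at every [Y] that is not a slope, so most of its coefficients have more
zeros than their degree allows and vanish.  The lacunary polynomials that remain
at the slopes show that its derivative in [X] depends on [Y] only; hence all
lines of a given slope that meet the graph meet it in the same number of points,
a power of [p].  Degree bounds on the lacunary polynomials then show that the
smallest such power [s] gives a subfield order, [q = s ^ (i + 1)], and that there
are more than [q / s] slopes unless [f] is affine.  In dimension three a level
set of [g] carries three families of lines, one more than a hyperbolic paraboloid
has, so it is a plane; in higher dimension the periods of [g] found on the slices
of [U] by coordinate hyperplanes span a hyperplane.

Two linear columns that can be added separately can be added together, unless
they have the same kernel ([compatible]).  After cutting down to dimension three,
a failure would give two points [P], [P'] extending a planar arc, on a line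
through a point [R] of that arc.  Segre's lemma of tangents, used in the form of
an antisymmetric double sum whose rows all vanish except the one at [P], refutes
this ([segre]).

Consequently a member of the family is maximal exactly when its columns represent,
besides the coordinates, all the functionals that extend [C], each of them once up
to scalars.  Two maximal members then differ by a permutation of the columns and
relabellings, and adding missing functionals one at a time reaches a maximal one. *)

(** * The Redei polynomial of a function *)

Section Directions.
Local Open Scope ring_scope.

Lemma card_field_setC (K : finFieldType) (A : {set K}) :
  (#|A| + #|~: A|)%N = #|K|.
Proof. exact: cardsC. Qed.

Lemma poly_eq0_card (K : finFieldType) (c : {poly K}) (A : {set K}) :
  (size c <= #|A|)%N -> {in A, forall y, c.[y] = 0} -> c = 0.
Proof.
move=> sc cA; apply/eqP/negPn/negP => c0.
have rA : all (root c) (enum A).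
  by apply/allP => y; rewrite mem_enum => yA; apply/rootP/cA.
by have := max_poly_roots c0 rA (enum_uniq _); rewrite -cardE ltnNge sc.
Qed.

(** In a product of linear factors whose constant terms have degree at most one in
a second variable, a factor contributes degree one to at most one of the two
variables; so a coefficient of high index has few zeros unless it vanishes. *)
Lemma coef_prod_size (K : fieldType) (I : Type) (s : seq I)
    (rho : I -> {poly K}) i :
  (forall x, (size (rho x) <= 2)%N) ->
  (size ((\prod_(x <- s) ('X - (rho x)%:P))`_i)%R <= (size s).+1 - i)%N.
Proof.
move=> rho2; elim: s i => [|x s IHs] i.
  by rewrite big_nil coef1; case: i => [|i] /=; rewrite ?size_poly1 ?size_poly0.
rewrite big_cons mulrBl coefB coefXM coefCM.
set Q := \prod_(_ <- s) _ in IHs *.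
have sM : (size (rho x * Q`_i)%R <= (size (x :: s)).+1 - i)%N.
  have [->|Qi0] := eqVneq Q`_i 0; first by rewrite mulr0 size_poly0.
  have := IHs i; have := size_polyMleq (rho x) Q`_i; have := rho2 x.
  have : (0 < size (Q`_i)%R)%N by rewrite lt0n size_poly_eq0.
  have nat_aux a b c n : (0 < a -> b <= 2 -> c <= (b + a).-1 -> a <= n.+1 - i ->
    c <= n.+2 - i)%N by lia.
  exact: nat_aux.
apply: leq_trans (size_polyD _ _) _; rewrite size_polyN geq_max sM andbT.
case: i {sM} => [|i] /=; first by rewrite size_poly0.
by have := IHs i; rewrite subSS.
Qed.

Lemma dvdp_mul_deriv_prod (K : fieldType) (I : Type) (s : seq I) (c : I -> K) G :
  (forall x, 'X - (c x)%:P %| G) ->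
  \prod_(x <- s) ('X - (c x)%:P) %| G * (\prod_(x <- s) ('X - (c x)%:P))^`().
Proof.
move=> cG; elim: s => [|x s IHs]; first by rewrite big_nil dvd1p.
rewrite big_cons derivM derivXsubC mul1r mulrDr dvdp_add //; first exact: dvdp_mul.
by rewrite mulrCA dvdp_mul.
Qed.

Variables (F : finFieldType) (f : F -> F).

(** The projection of the graph of [f] along the lines of slope [y]. *)
Definition shear (y x : F) : F := f x - x * y.

Definition slopes : {set F} := [set y | ~~ injectiveb (shear y)].

(** A polynomial in [X] over [F[Y]] whose roots are the shears of [f] with a
variable slope [Y]. *)
Definition redei : {poly {poly F}} :=
  \prod_(x : F) ('X - ((f x)%:P - x *: 'X)%:P).

Definition fibre_poly (y : F) : {poly F} := \prod_(x : F) ('X - (shear y x)%:P).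

Lemma redei_horner y i : (redei`_i).[y] = (fibre_poly y)`_i.
Proof.
have -> : fibre_poly y = map_poly (horner_eval y) redei.
  rewrite /redei rmorph_prod; apply: eq_bigr => x _ /=.
  by rewrite map_polyXsubC /= /horner_eval /shear !hornerE.
by rewrite coef_map.
Qed.

Lemma size_redei_coef i : (size (redei`_i)%R <= #|F|.+1 - i)%N.
Proof.
have /(_ (index_enum F) i) := coef_prod_size (rho := fun x : F => (f x)%:P - x *: 'X) _ _.
have -> : size (index_enum F) = #|F| by rewrite [index_enum _]unlock -enumT -cardE.
apply => x; apply: leq_trans (size_polyD _ _) _.
rewrite geq_max size_polyN (leq_trans (size_polyC_leq1 _)) //=.
by rewrite (leq_trans (size_scale_leq _ _)) // size_polyX.
Qed.

Lemma fibre_poly_monic y : fibre_poly y \is monic.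
Proof. exact: monic_prod_XsubC. Qed.

Lemma size_fibre_poly y : size (fibre_poly y) = #|F|.+1.
Proof. by rewrite size_prod_XsubC [index_enum _]unlock -enumT -cardE. Qed.

Lemma fibre_poly_nonslope y : y \notin slopes -> fibre_poly y = 'X^#|F| - 'X.
Proof.
rewrite inE negbK => /injectiveP inj; rewrite finField_genPoly /fibre_poly.
by rewrite [RHS](reindex_inj inj).
Qed.

(** At a [y] that is not a slope the Redei polynomial becomes [X^q - X], which
provides [q - #|slopes|] zeros for each of the middle coefficients. *)
Lemma redei_coef0 i : (1 < i)%N -> (#|slopes| < i < #|F|)%N -> redei`_i = 0.
Proof.
move=> i1 /andP[Ni iq].
apply: (@poly_eq0_card F _ (~: slopes)) => [|y].
  apply: leq_trans (size_redei_coef i) _.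
  by have := card_field_setC slopes; lia.
rewrite inE => /fibre_poly_nonslope ry; rewrite redei_horner ry.
by rewrite coefB coefXn coefX (ltn_eqF iq) (gtn_eqF i1) subrr.
Qed.

Lemma fibre_poly_lacunary y : (0 < #|slopes|)%N -> (#|slopes| < #|F|)%N ->
  exists2 g, fibre_poly y = 'X^#|F| + g & (size g <= #|slopes|.+1)%N.
Proof.
move=> N0 Nq; exists (fibre_poly y - 'X^#|F|); first by rewrite addrC subrK.
apply/leq_sizeP => j Nj; rewrite coefB coefXn.
have [->|jq] := eqVneq j #|F|.
  have := fibre_poly_monic y; rewrite monicE lead_coefE size_fibre_poly /=.
  by move/eqP->; rewrite subrr.
have [jq'|] := ltnP j #|F|; last first.
  move=> qj; have: (#|F| < j)%N by rewrite ltn_neqAle eq_sym jq.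
  by move=> qj'; rewrite nth_default ?subrr // size_fibre_poly.
by rewrite -redei_horner redei_coef0 ?horner0 ?subrr // ?Nj //; lia.
Qed.

Lemma fibre_poly_dvd y : fibre_poly y %| ('X^#|F| - 'X) * (fibre_poly y)^`().
Proof.
apply: dvdp_mul_deriv_prod => x; rewrite finField_genPoly.
by rewrite (bigD1 (shear y x)) //= dvdp_mulIl.
Qed.

Definition fibre_size (y u : F) := #|[set x | shear y x == shear y u]|.

Variables (p h : nat).
Hypotheses (p_prime : prime p) (cardF : #|F| = (p ^ h)%N) (p_gt2 : (2 < p)%N).

Lemma pcharF : p \in [pchar F].
Proof. exact: card_finPcharP cardF p_prime. Qed.

Lemma card_gt1 : (1 < #|F|)%N.
Proof. exact: finRing_gt1. Qed.

Lemma h_gt0 : (0 < h)%N.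
Proof. by have := card_gt1; rewrite cardF; case: h. Qed.

Lemma natp_poly0 : p%:R = 0 :> {poly F}.
Proof. by apply: pcharf0; rewrite pchar_poly pcharF. Qed.

Lemma deriv_Xq : ('X^#|F| : {poly F})^`() = 0.
Proof.
rewrite derivXn -mulr_natr cardF natrX natp_poly0 expr0n -[h == 0%N]negbK -lt0n h_gt0.
by rewrite mulr0.
Qed.

Lemma shear_eq y u v : (shear y u == shear y v) = (f u - f v == (u - v) * y).
Proof. by rewrite /shear -subr_eq0 -[RHS]subr_eq0; congr (_ == _); ring. Qed.

Lemma slopesP y :
  reflect (exists u v, u != v /\ shear y u = shear y v) (y \in slopes).
Proof.
rewrite inE; apply: (iffP (injectivePn _)) => [[u [v uv e]]|[u [v [uv e]]]].
  by exists u, v; rewrite uv.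
by exists u, v.
Qed.

Lemma slope_in u v : u != v -> (f u - f v) / (u - v) \in slopes.
Proof.
move=> uv; apply/slopesP; exists u, v; split=> //; apply/eqP.
by rewrite shear_eq mulrC divfK // subr_eq0.
Qed.

Lemma slopes_gt0 : (0 < #|slopes|)%N.
Proof. by apply/card_gt0P; eexists; apply: (@slope_in 1 0); apply: oner_neq0. Qed.

Hypothesis few_slopes : (2 * #|slopes| <= #|F|)%N.

(** Being a product of linear factors over [F], the fibre polynomial [r = X^q + g]
divides [(X^q - X) r'], hence also [(g + X) g'], which has degree less than [q]
because there are few slopes.  So [g' = 0], unless [g = - X]; but then [r] would
have no multiple root and [y] would not be a slope. *)
Lemma deriv_fibre_poly y : y \in slopes -> (fibre_poly y)^`() = 0.
Proof.
move=> ys; have Nq : (#|slopes| < #|F|)%N by have := slopes_gt0; lia.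
have [g rE sg] := fibre_poly_lacunary y slopes_gt0 Nq.
have r'E : (fibre_poly y)^`() = g^`() by rewrite rE derivD deriv_Xq add0r.
have sgX : (size (g + 'X)%R <= #|slopes|.+1)%N.
  apply: leq_trans (size_polyD _ _) _; rewrite geq_max sg size_polyX /=.
  exact: slopes_gt0.
have : fibre_poly y %| (g + 'X) * g^`().
  have := fibre_poly_dvd y; rewrite r'E.
  have -> : 'X^#|F| - 'X = fibre_poly y - (g + 'X) :> {poly F} by rewrite rE; ring.
  by rewrite mulrBl dvdp_subr // dvdp_mulIl.
have [/eqP|g0 /(dvdp_leq g0)] := eqVneq ((g + 'X) * g^`()) 0; last first.
  rewrite size_fibre_poly => /leq_trans/(_ (size_polyMleq _ _)) le_q.
  have sg' : (size g^`() < size g)%N.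
    by apply: lt_size_deriv; apply: contraNneq g0 => ->; rewrite deriv0 mulr0.
  (* the degree of (g + X) g' is at most 2 #|slopes| - 1 *)
  suff: (#|F|.+1 <= 2 * #|slopes|)%N by lia.
  apply: leq_trans le_q _.
  have aux a b c n : (a <= n.+1 -> b < c -> c <= n.+1 -> (a + b).-1 <= 2 * n)%N by lia.
  exact: aux sgX sg' sg.
rewrite mulf_eq0 => /orP[|/eqP g'0 _]; last by rewrite r'E.
rewrite addr_eq0 => /eqP gE _; have [u [v [uv cuv]]] := slopesP _ ys.
have : ((fibre_poly y)^`()).[shear y u] = 0.
  rewrite /fibre_poly (bigD1 u) //= (bigD1 v) /=; last by rewrite eq_sym.
  by rewrite !derivM !derivXsubC !hornerE /= cuv; ring.
rewrite r'E gE derivN derivX !hornerE => /eqP.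
by rewrite oppr_eq0 oner_eq0.
Qed.

(** The coefficients of positive index of the derivative in [X] vanish at every
[y]: the derivative is [0] at a slope and [-1] elsewhere.  Their degree in [Y] is
less than [q]. *)
Lemma deriv_redei : redei^`() = ((redei^`())`_0)%:P.
Proof.
apply/polyP => i; rewrite coefC; case: i => [|i] //=.
apply: (@poly_eq0_card F _ setT) => [|y _].
  rewrite cardsT coef_deriv -scaler_nat; apply: leq_trans (size_scale_leq _ _) _.
  by apply: leq_trans (size_redei_coef _) _; rewrite subSS leq_subr.
rewrite coef_deriv hornerMn redei_horner -coef_deriv.
have [ys|ys] := boolP (y \in slopes); first by rewrite deriv_fibre_poly // coef0.
rewrite fibre_poly_nonslope // derivB derivX deriv_Xq sub0r coefN coef1.
by rewrite oppr0.
Qed.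

(** Substituting the root of index [u] for [X] leaves a single term of the product
rule; the outcome does not depend on [u]. *)
Lemma redei_deriv_at u : (redei^`())`_0 =
  \prod_(x | x != u) ((f u - f x)%:P - (u - x) *: 'X).
Proof.
set rho := fun x : F => (f x)%:P - x *: 'X.
have -> : (redei^`())`_0 = (redei^`()).[rho u] by rewrite deriv_redei hornerC coefC.
rewrite /redei (bigD1 u) //= derivM derivXsubC mul1r hornerD hornerM hornerXsubC.
rewrite subrr mul0r addr0 horner_prod; apply: eq_bigr => x _.
by rewrite hornerXsubC /rho rmorphB scalerBl /=; ring.
Qed.

Lemma mup_prod (I : finType) (P : pred I) (G : I -> {poly F}) y :
  (forall i, P i -> G i != 0) ->
  mup y (\prod_(i | P i) G i) = (\sum_(i | P i) mup y (G i))%N.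
Proof.
move=> G0; suff: \prod_(i | P i) G i != 0 /\
  mup y (\prod_(i | P i) G i) = (\sum_(i | P i) mup y (G i))%N by case.
apply: (big_rec2 (fun a b => a != 0 /\ mup y a = b)).
  by rewrite oner_neq0 mupNroot // rootE hornerC oner_eq0.
by move=> i b a Pi [a0 <-]; rewrite mulf_neq0 ?mupM ?G0.
Qed.

Lemma mup_linear y a b : b != 0 -> mup y (a%:P - b *: 'X) = (a == b * y :> F).
Proof.
move=> b0; have -> : a%:P - b *: 'X = (- b)%:P * ('X - (a / b)%:P) ^+ 1.
  rewrite expr1 mulrBr -rmorphM /= mulNr mulrCA divff // mulr1.
  by rewrite rmorphN mulNr mul_polyC /= rmorphN /=; ring.
rewrite mupMr; last by rewrite rootE hornerC oppr_eq0.
rewrite mup_XsubCX; have -> : (a == b * y) = (y == a / b).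
  by apply/eqP/eqP => [->|->]; rewrite ?[b * y]mulrC ?mulfK // mulrC divfK.
by rewrite eq_sym; case: (y == _).
Qed.

Lemma fibre_size_mup y u : fibre_size y u = (mup y (redei^`())`_0).+1.
Proof.
rewrite (redei_deriv_at u) mup_prod => [|x xu]; last first.
  apply/eqP => /(congr1 (fun P : {poly F} => P`_1)).
  rewrite coefB coefC coefZ coefX coef0 mulr1 sub0r => /eqP.
  by rewrite oppr_eq0 subr_eq0 eq_sym (negPf xu).
rewrite /fibre_size (cardsD1 u) inE eqxx add1n; congr _.+1.
rewrite -sum1_card big_mkcond [RHS]big_mkcond; apply: eq_bigr => x _.
rewrite !inE eq_sym; have [//|xu] := eqVneq u x.
by rewrite mup_linear ?subr_eq0 // eq_sym shear_eq; case: eqP.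
Qed.

(** The multiplicity of [y] as a root of the derivative, a polynomial in [Y] alone,
counts the further points of the graph on the line of slope [y] through the point
of abscissa [u]. *)
Lemma fibre_size_uniform y u v : fibre_size y u = fibre_size y v.
Proof. by rewrite !fibre_size_mup. Qed.

Local Notation mult y := (fibre_size y 0%R).

Lemma fibre_size_gt1 y : y \in slopes -> (1 < mult y)%N.
Proof.
case/slopesP => u [v [uv e]]; rewrite (fibre_size_uniform y 0 u) /fibre_size.
rewrite (cardsD1 u) (cardsD1 v) !inE eqxx e eqxx andbT eq_sym uv.
by [].
Qed.

Definition shear_image y : {set F} := shear y @: setT.

Lemma card_fibres y : (#|shear_image y| * mult y)%N = #|F|.
Proof.
rewrite -sum_nat_const -cardsT -[RHS]sum1_card.
rewrite [RHS](partition_big_imset (shear y)) /=; apply: eq_bigr => c.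
case/imsetP => u _ ->; rewrite (fibre_size_uniform y 0 u) /fibre_size -sum1_card.
by apply: eq_bigl => x; rewrite !inE.
Qed.

Definition image_poly y : {poly F} := \prod_(c in shear_image y) ('X - c%:P).

Lemma fibre_polyE y : fibre_poly y = image_poly y ^+ mult y.
Proof.
rewrite /fibre_poly /image_poly -prodrXl.
have -> : \prod_(x : F) ('X - (shear y x)%:P) =
          \prod_(x in [set: F]) ('X - (shear y x)%:P).
  by apply: eq_bigl => x; rewrite inE.
rewrite (partition_big_imset (shear y)) /=; apply: eq_bigr => c.
case/imsetP => u _ ->; rewrite (fibre_size_uniform y 0 u) /fibre_size.
rewrite (eq_bigr (fun=> 'X - (shear y u)%:P)) => [|x /andP[_ /eqP-> //]].
rewrite prodr_const; congr (_ ^+ _); apply: eq_card => x.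
by rewrite inE [LHS]/in_mem /= inE.
Qed.

Lemma image_poly_monic y : image_poly y \is monic.
Proof. exact: monic_prod_XsubC. Qed.

Lemma size_image_poly y : size (image_poly y) = #|shear_image y|.+1.
Proof. by rewrite /image_poly -big_enum /= size_prod_XsubC -cardE. Qed.

Lemma image_poly_dvd y : image_poly y %| 'X^#|F| - 'X.
Proof.
by rewrite finField_genPoly (bigID (mem (shear_image y))) /= dvdp_mulIl.
Qed.

Lemma fibre_size_pow y : exists2 e, (e <= h)%N & mult y = (p ^ e)%N.
Proof. by apply/(dvdn_pfactor _ _ p_prime); rewrite -cardF -(card_fibres y) dvdn_mull. Qed.

(** The points other than the one of abscissa [0] are distributed among the lines
through it. *)
Lemma sum_fibre_sizes :
  (\sum_(y in slopes) (mult y).-1)%N = #|F|.-1.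
Proof.
have -> : #|F|.-1 = (\sum_(x | x != 0%R :> F) 1)%N.
  rewrite sum1_card -(cardC1 (0 : F)).
  by apply: eq_card => x; rewrite !inE.
rewrite [RHS](partition_big (fun x => (f 0 - f x) / (0 - x)) (mem slopes)) /=; last first.
  by move=> x x0; apply: slope_in; rewrite eq_sym.
apply: eq_bigr => y _; rewrite /fibre_size (cardsD1 0) inE eqxx add1n /=.
rewrite sum1_card; apply: eq_card => x; rewrite !inE /in_mem /=.
have [//|x0 /=] := eqVneq x 0; rewrite eq_sym shear_eq.
have x0' : 0 - x != 0 by rewrite sub0r oppr_eq0.
by apply/eqP/eqP => [->|<-]; [rewrite [_ * y]mulrC mulfK | rewrite mulrC divfK].
Qed.

Lemma pchar_nat e : ([pchar F]).-nat (p ^ e)%N.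
Proof. by rewrite (eq_pnat _ (pcharf_eq pcharF)) pnatX pnat_id ?orbT. Qed.

Lemma pchar_poly_nat e : ([pchar {poly F}]).-nat (p ^ e)%N.
Proof. by rewrite (eq_pnat _ (pchar_poly F)) pchar_nat. Qed.

(** Raising to a power of the characteristic is additive, so it raises each
coefficient to that power and multiplies its index by it. *)
Lemma coef_Frobenius (H : {poly F}) e j :
  (H ^+ (p ^ e))`_(p ^ e * j) = H`_j ^+ (p ^ e).
Proof.
have s0 : (0 < p ^ e)%N by rewrite expn_gt0 prime_gt0.
elim/poly_ind: H j => [|H c IH] j.
  by rewrite expr0n coef0 expr0n gtn_eqF //= coef0.
rewrite exprDn_pchar ?pchar_poly_nat // exprMn -polyC_exp coefD coefMXn coefC.
case: j => [|j]; first by rewrite muln0 s0 coefD coefMX coefC eqxx add0r add0r.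
rewrite mulnS ltnNge leq_addr /= addKn IH coefD coefMX coefC /= addr0.
by rewrite addn_eq0 gtn_eqF //= addr0.
Qed.

(** * Lacunary polynomials and the order of a subfield *)

(** Since all fibres have the same size [s], the fibre polynomial is [P ^ s] for a
separable [P], and [s] is a power of [p]: the gap below the leading term of
[P ^ s] is already present in [P = X^Q + H].  Moreover [P] divides
[X^q - X = P ^ s - (H ^ s + X)]. *)
Lemma lacunary_root y : y \in slopes -> exists H : {poly F},
  [/\ image_poly y = 'X^#|shear_image y| + H,
      (size H <= #|shear_image y|)%N,
      ((size H).-1 * mult y <= #|slopes|)%N &
      image_poly y %| H ^+ mult y + 'X].
Proof.
move=> ys; have [e _ sE] := fibre_size_pow y.
have Nq : (#|slopes| < #|F|)%N by have := slopes_gt0; lia.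
have [g rE sg] := fibre_poly_lacunary y slopes_gt0 Nq.
pose H := image_poly y - 'X^#|shear_image y|; exists H.
have PE : image_poly y = 'X^#|shear_image y| + H by rewrite addrC subrK.
have XE : image_poly y ^+ mult y = 'X^#|F| + H ^+ mult y.
  by rewrite PE sE exprDn_pchar ?pchar_poly_nat // -exprM -sE card_fibres.
split=> //.
- apply/leq_sizeP => j Qj; rewrite coefB coefXn; have [->|jQ] := eqVneq j.
    have := image_poly_monic y; rewrite monicE lead_coefE size_image_poly /=.
    by move/eqP->; rewrite subrr.
  by rewrite nth_default ?subrr // size_image_poly ltn_neqAle eq_sym jQ.
- have -> : ((size H).-1 * mult y)%N = (size g).-1.
    by rewrite -size_exp -[g](addKr 'X^#|F|) -rE fibre_polyE XE addKr.
  by case: (size g) sg.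
have := image_poly_dvd y.
have -> : 'X^#|F| - 'X = image_poly y ^+ mult y - (H ^+ mult y + 'X).
  by rewrite XE; ring.
rewrite dvdp_subr //; apply: dvdp_exp => //.
by apply: ltnW; apply: fibre_size_gt1.
Qed.

(** Otherwise [H ^ s + X] would be a multiple of [P] of smaller degree. *)
Lemma image_le_slopes y : y \in slopes -> (#|shear_image y| <= #|slopes|)%N.
Proof.
move=> ys; have [H [_ sH dN Pdvd]] := lacunary_root ys.
have s1 := fibre_size_gt1 ys; rewrite leqNgt; apply/negP => NQ.
have szHs : (size (H ^+ mult y) <= #|slopes|.+1)%N.
  by apply: leq_trans (leqSpred _) _; rewrite ltnS size_exp.
have [Hs0|/(dvdp_leq)/(_ Pdvd)] := eqVneq (H ^+ mult y + 'X) 0.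
  have : (size (H ^+ mult y)).-1 = 1%N.
    by move/eqP: Hs0; rewrite addr_eq0 => /eqP->; rewrite size_polyN size_polyX.
  by rewrite size_exp; nia.
rewrite size_image_poly => /leq_trans/(_ (size_polyD _ _)).
rewrite size_polyX leq_max => /orP[/leq_trans/(_ szHs)|]; first by lia.
by have := slopes_gt0; lia.
Qed.

Lemma fibre_size_p y : y \in slopes -> (p %| mult y)%N.
Proof.
move=> ys; have := fibre_size_gt1 ys; have [e _ ->] := fibre_size_pow y.
by case: e => // e _; rewrite expnS dvdn_mulr.
Qed.

(** The sizes of the lines through one point of the graph are multiples of [p], and
their sum is [q - 1 + #|slopes|]. *)
Lemma card_slopes_mod : (p %| #|slopes|.-1)%N.
Proof.
have : (\sum_(y in slopes) mult y = #|F| + #|slopes|.-1)%N.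
  have sE : (\sum_(y in slopes) mult y =
             \sum_(y in slopes) (mult y).-1 + \sum_(y in slopes) 1)%N.
    rewrite -big_split; apply: eq_bigr => y ys /=.
    by have := fibre_size_gt1 ys; lia.
  have N1 : (\sum_(y in slopes) 1 = #|slopes|)%N by rewrite sum1_card.
  rewrite sE sum_fibre_sizes N1.
  by have := slopes_gt0; have := card_gt1; lia.
move=> E; have : (p %| #|F| + #|slopes|.-1)%N.
  by rewrite -E; apply: dvdn_sum => y ys; apply: fibre_size_p.
by rewrite dvdn_addr // cardF dvdn_exp // h_gt0.
Qed.

(** Equality would make [p] divide both the number of slopes and its predecessor. *)
Lemma image_lt_slopes y : y \in slopes -> (1 < #|shear_image y|)%N ->
  (#|shear_image y| < #|slopes|)%N.
Proof.
move=> ys Q1; rewrite ltn_neqAle image_le_slopes // andbT; apply/eqP => QN.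
have [b _ QE] : exists2 b, (b <= h)%N & #|shear_image y| = (p ^ b)%N.
  apply/(dvdn_pfactor _ _ p_prime); rewrite -cardF -(card_fibres y) dvdn_mulr //.
have : (p %| #|shear_image y|)%N.
  by move: Q1; rewrite QE; case: (b) => // b' _; rewrite expnS dvdn_mulr.
have := card_slopes_mod; rewrite QN; case: #|slopes| slopes_gt0 => // n _ /= pn.
by rewrite -addn1 dvdn_addr // Euclid_dvd1.
Qed.

(** The slope whose lines have the least size bounds the number of slopes, because
the other lines through a given point have at least as many points. *)
Lemma exists_min_fibre : exists2 y, y \in slopes &
  (#|slopes| * (mult y).-1 <= #|F|.-1)%N.
Proof.
have [y0 y0s] : exists y, y \in slopes by apply/card_gt0P/slopes_gt0.
have [y ys ymin] := @arg_minnP _ y0 (mem slopes) (fun y => mult y) y0s.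
exists y => //; rewrite -sum_fibre_sizes -sum_nat_const leq_sum // => z zs.
by have := ymin _ zs; rewrite -!subn1 => /leq_sub2r.
Qed.

(** Differentiating [H ^ s + X = w P] gives [w' P = 1 - w H'].  By minimality of [s]
the right side has smaller degree than [P], so [w' = 0] and [w H' = 1]; thus [w] is a
nonzero constant, and so is [H'].  Compare the coefficients of [H ^ s + X] and
[w (X^Q + H)]: the one of [X] in [H] is nonzero, and [w] times the one of index
[s ^ (i + 1)] is the [s]-th power of the one of index [s ^ i], unless the index is
[Q].  As [H] is a polynomial, [Q] must be one of the [s ^ i]. *)
Lemma subfield_order y : y \in slopes -> (1 < #|shear_image y|)%N ->
  (#|slopes| * (mult y).-1 <= #|F|.-1)%N ->
  exists i, #|shear_image y| = (mult y ^ i)%N.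
Proof.
move=> ys Q1 Nmin; have [H [PE sH dN]] := lacunary_root ys.
have s1 := fibre_size_gt1 ys; have QN := image_lt_slopes ys Q1.
have qE := card_fibres y; have [e _ sE] := fibre_size_pow y.
have s3 : (2 < mult y)%N.
  by apply: leq_trans p_gt2 _; apply: dvdn_leq; [lia | exact: fibre_size_p].
have pQ : (p %| #|shear_image y|)%N.
  have [b _ QE] : exists2 b, (b <= h)%N & #|shear_image y| = (p ^ b)%N.
    by apply/(dvdn_pfactor _ _ p_prime); rewrite -cardF -(card_fibres y) dvdn_mulr.
  by move: Q1; rewrite QE; case: (b) => // b' _; rewrite expnS dvdn_mulr.
have deriv0p n : (p %| n)%N -> forall G : {poly F}, (G ^+ n)^`() = 0.
  move=> /dvdnP[n' ->] G; rewrite deriv_exp -mulr_natr.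
  have -> : (n' * p)%:R = 0 :> {poly F}.
    by rewrite natrM natp_poly0 mulr0.
  by rewrite mulr0.
set Q := #|shear_image y| in Q1 QN qE PE sH pQ *.
set N := #|slopes| in Nmin QN dN; set s := mult y in s1 qE s3 sE dN Nmin *.
case/dvdpP => w E.
have Q2 : (2 < Q)%N by apply: leq_trans p_gt2 _; apply: dvdn_leq => //; lia.
have P0 : image_poly y != 0 by apply: monic_neq0; apply: image_poly_monic.
have szHs : (size (H ^+ s) <= (size H).-1 * s + 1)%N.
  by apply: leq_trans (leqSpred _) _; rewrite addn1 ltnS size_exp.
have X0 : H ^+ s + 'X != 0.
  apply/eqP => Hs0; have : (size (H ^+ s)).-1 = 1%N.
    by move/eqP: Hs0; rewrite addr_eq0 => /eqP->; rewrite size_polyN size_polyX.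
  by rewrite size_exp; nia.
have w0 : w != 0 by apply: contraNneq X0 => w0; rewrite E w0 mul0r.
have szw : (size w + Q <= (size H).-1 * s + 1)%N.
  have : (size w + Q <= maxn (size (H ^+ s)) 2)%N.
    have <- : size (H ^+ s + 'X) = (size w + Q)%N.
      by rewrite E size_mul // size_image_poly addnS.
    by apply: leq_trans (size_polyD _ _) _; rewrite size_polyX.
  have : (0 < size w)%N by rewrite size_poly_gt0.
  by move: szHs; lia.
(* s d <= N and N (s - 1) < Q s give d (s - 1) < Q; then s + 1 <= 2 (s - 1) *)
have d_bound : ((size H).-1 * (s + 1) <= 2 * Q)%N.
  have q0 : (0 < #|F|)%N by have := card_gt1; lia.
  have : ((size H).-1 * (s - 1) < Q)%N by nia.
  by nia.
have derivE : w^`() * image_poly y = 1 - w * H^`().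
  have := congr1 (@deriv F) E; rewrite derivD derivX deriv0p ?fibre_size_p // add0r.
  rewrite derivM {2}PE derivD derivXn -mulr_natr.
  have -> : Q%:R = 0 :> {poly F}.
    by case/dvdnP: pQ => b ->; rewrite natrM natp_poly0 mulr0.
  by rewrite mulr0 add0r => ->; ring.
have szwH : (size (1 - w * H^`())%R <= Q)%N.
  apply: leq_trans (size_polyD _ _) _; rewrite size_poly1 size_polyN geq_max.
  rewrite (leq_trans _ (ltnW Q2)) //=.
  have [->|H'0] := eqVneq H^`() 0; first by rewrite mulr0 size_poly0.
  have szH' : (size H^`() < size H)%N.
    by apply: lt_size_deriv; apply: contraNneq H'0 => ->; rewrite deriv0.
  apply: leq_trans (size_polyMleq _ _) _.
  have aux a b c m r : (a + r <= m + 1 -> b < c -> m + c.-1 <= 2 * r ->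
    (a + b).-1 <= r)%N by lia.
  by apply: aux szw szH' _; move: d_bound; rewrite mulnDr muln1.
have w'0 : w^`() = 0.
  apply/eqP; apply: contraTT szwH => w'0; rewrite -derivE size_mul //.
  rewrite size_image_poly addnS /= -ltnNge.
  by rewrite -[X in (X <= _)%N]add1n leq_add2r size_poly_gt0.
have wH1 : w * H^`() = 1.
  by apply/eqP; rewrite eq_sym -subr_eq0 -derivE w'0 mul0r.
have /andP[/size_poly1P[c c0 wE] /size_poly1P[c' c'0 H'E]] :
    (size w == 1%N) && (size H^`() == 1%N).
  by rewrite -size_mul_eq1 wH1 size_poly1.
have coefE j : (H ^+ s)`_j + (j == 1%N)%:R = c * ((j == Q)%:R + H`_j).
  have := congr1 (fun G : {poly F} => G`_j) E.
  by rewrite wE PE mul_polyC coefZ !coefD coefX coefXn.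
have H1 : H`_1 != 0.
  have := congr1 (fun G : {poly F} => G`_0) H'E.
  by rewrite /= coef_deriv mulr1n coefC /= => ->.
have [/existsP[i /eqP QE]|none] := boolP [exists i : 'I_(size H).+1, Q == s ^ i]%N.
  by exists i.
have Hn i : (i <= size H)%N -> H`_(s ^ i) != 0.
  elim: i => [//|i IHi] iH; have := coefE (s ^ i.+1)%N.
  have /negPf-> : (s ^ i.+1 != Q)%N.
    by apply: contraNneq none => <-; apply/existsP; exists (inord i.+1); rewrite inordK.
  have /negPf-> : (s ^ i.+1 != 1)%N by rewrite -(expn0 s) eqn_exp2l.
  have -> : (H ^+ s)`_(s ^ i.+1) = H`_(s ^ i) ^+ s by rewrite expnS sE coef_Frobenius.
  rewrite addr0 add0r => E2.
  apply/eqP => H0; move: E2; rewrite H0 mulr0 => /eqP.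
  by rewrite expf_eq0 (negPf (IHi (ltnW iH))) andbF.
by have := Hn _ (leqnn (size H)); rewrite nth_default ?eqxx // ltnW // ltn_expl.
Qed.

End Directions.

(** A line of minimal size [s] yields [q = s ^ (i + 1)], so [s = p ^ e] with [e] a
divisor of [h].  If [i = 0], all points of the graph are on one line.  Otherwise
[e <= t], and there are more than [q / s >= p ^ (h - t)] slopes. *)
Theorem few_slopes_affine (p h t : nat) (F : finFieldType) (f : F -> F) :
  prime p -> #|F| = (p ^ h)%N -> (2 < p)%N ->
  t %| h -> (t < h)%N -> (forall d : nat, d %| h -> d < h -> d <= t)%N ->
  (#|slopes f| <= p ^ (h - t))%N ->
  exists c, forall x, f x = (f 0 + x * c)%R.
Proof.
move=> p_prime cardF p_gt2 th t_lt t_max few.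
have t_gt0 : (0 < t)%N by case: t th t_lt {t_max few} => //; rewrite dvd0n => /eqP->.
have p_gt0 := prime_gt0 p_prime; have p_gt1 := prime_gt1 p_prime.
have few2 : (2 * #|slopes f| <= #|F|)%N.
  apply: leq_trans (leq_mul (leqnn 2) few) _; rewrite cardF.
  rewrite -{2}(subnKC (ltnW t_lt)) expnD leq_mul2r.
  by rewrite (leq_trans (ltnW p_gt2)) ?orbT // -{1}(expn1 p) leq_exp2l.
have [y ys ymin] := exists_min_fibre f.
have [Q1|Q1] := ltnP 1 #|shear_image f y|; last first.
  exists y => x; apply/eqP; rewrite -subr_eq0 opprD addrA subr_eq0.
  suff /eqP : shear f y x = shear f y 0%R.
    by rewrite (shear_eq f) subr0.
  apply/eqP; apply: contraTT Q1 => xy; rewrite -ltnNge.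
  apply: leq_trans (_ : #|[set shear f y x; shear f y 0%R]| <= _)%N.
    by rewrite cards2 xy.
  by apply/subset_leq_card/subsetP => z /set2P[]->; apply: imset_f; rewrite inE.
have [i QE] := subfield_order p_prime cardF p_gt2 few2 ys Q1 ymin.
have QN := image_lt_slopes p_prime cardF p_gt2 few2 ys Q1.
have [e _ sE] := fibre_size_pow p_prime cardF p_gt2 few2 y.
have qE := card_fibres p_prime cardF p_gt2 few2 y.
have s1 := fibre_size_gt1 p_prime cardF p_gt2 few2 ys.
have hE : h = (e * i.+1)%N.
  apply/eqP; rewrite -(eqn_exp2l _ _ p_gt1) -cardF -qE QE sE -expnM -expnD.
  by rewrite mulnS addnC.
have e_gt0 : (0 < e)%N by case: (e) sE s1 => // ->.
have i_gt0 : (0 < i)%N by case: (i) QE Q1 => // ->.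
have et : (e <= t)%N by apply: t_max; rewrite hE ?dvdn_mulr // -{1}(muln1 e) ltn_pmul2l.
suff : (p ^ (h - t) <= #|shear_image f y|)%N by lia.
by rewrite QE sE -expnM leq_exp2l // leq_subLR hE mulnS leq_add2r.
Qed.

(** * Functionals on a space of words *)

Section Functionals.
Local Open Scope ring_scope.
Variables (F : finFieldType) (n : nat).
Implicit Types (x y z : 'rV[F]_n) (c : 'cV[F]_n) (S : {set 'cV[F]_n}).
Implicit Types (W Z H : {vspace 'rV[F]_n}) (s : seq 'cV[F]_n).

(** A linear functional on words is encoded by a column vector, so that sets of
functionals are finite sets. *)
Definition ev x c : F := (x *m c) ord0 ord0.

Lemma evD x y c : ev (x + y) c = ev x c + ev y c.
Proof. by rewrite /ev mulmxDl mxE. Qed.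

Lemma evN x c : ev (- x) c = - ev x c.
Proof. by rewrite /ev mulNmx mxE. Qed.

Lemma evB x y c : ev (x - y) c = ev x c - ev y c.
Proof. by rewrite evD evN. Qed.

Lemma evZ a x c : ev (a *: x) c = a * ev x c.
Proof. by rewrite /ev -scalemxAl mxE. Qed.

Lemma ev0 c : ev 0 c = 0.
Proof. by rewrite /ev mul0mx mxE. Qed.

Definition kernel c : {vspace 'rV[F]_n} := lker (linfun (mulmxr c : 'rV[F]_n -> 'rV[F]_1)).

Lemma mem_kernel x c : (x \in kernel c) = (ev x c == 0).
Proof.
rewrite memv_ker lfunE /= /ev; apply/eqP/eqP => [->|e]; first by rewrite mxE.
by apply/matrixP => i j; rewrite !ord1 e mxE.
Qed.

Lemma dim_cap_kernel Z c : (\dim Z <= (\dim (Z :&: kernel c)).+1)%N.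
Proof.
set l := linfun (mulmxr c : 'rV[F]_n -> 'rV[F]_1).
have : (\dim (l @: Z) <= 1)%N.
  by apply: leq_trans (dimvS (subvf _)) _; rewrite dimvf /dim /= mul1n.
have : (\dim (Z :&: kernel c) + \dim (l @: Z) = \dim Z)%N := limg_ker_dim l Z.
by lia.
Qed.

Definition zeros S x : nat := #|[set c in S | ev x c == 0]|.

Lemma zeros_ge S s x : uniq s -> {subset s <= S} ->
  (forall c, c \in s -> ev x c = 0) -> (size s <= zeros S x)%N.
Proof.
move=> us sS s0; rewrite -(card_uniqP us); apply/subset_leq_card/subsetP => c cs.
by rewrite inE sS //= s0.
Qed.

(** Each functional lowers the dimension by at most one. *)
Lemma common_zero Z s : (size s < \dim Z)%N ->
  exists z, [/\ z \in Z, z != 0 & forall c, c \in s -> ev z c = 0].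
Proof.
elim: s Z => [|c s IHs] Z sZ.
  exists (vpick Z); rewrite memv_pick vpick0; split=> //.
  by apply: contraTneq sZ => ->; rewrite dimv0.
have /IHs[z [zZ z0 zs]] : (size s < \dim (Z :&: kernel c))%N.
  by have := dim_cap_kernel Z c; move: sZ => /=; lia.
move: zZ; rewrite memv_cap mem_kernel => /andP[zZ /eqP zc].
by exists z; split=> // c'; rewrite inE => /predU1P[->//|/zs].
Qed.

Lemma many_zeros Z S r : (r < \dim Z)%N -> (r <= #|S|)%N ->
  exists z, [/\ z \in Z, z != 0 & (r <= zeros S z)%N].
Proof.
move=> rZ rS; pose s := take r (enum S).
have ss : size s = r by rewrite size_takel // -cardE.
have [z [zZ z0 zs]] := @common_zero Z s (eq_ind_r (fun m => m < \dim Z)%N rZ ss).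
exists z; split=> //; rewrite -ss zeros_ge ?take_uniq ?enum_uniq //.
by move=> c /mem_take; rewrite mem_enum.
Qed.

(** For [W] of dimension [k + 1] this says that any [k + 1] functionals of [S] are
independent on [W], that is, [S] is an arc of the dual space; equivalently, the
values of [S] on [W] form an MDS code. *)
Definition arc_on W S k := forall x, x \in W -> x != 0 -> (zeros S x <= k)%N.

(** The condition under which [g] can be appended to the MDS code of the values of
[S] on [W]. *)
Definition new_column W S k (g : 'rV[F]_n -> F) :=
  forall x y, x \in W -> y \in W -> x != y -> g x = g y -> (zeros S (x - y) < k)%N.

Lemma arc_eq0 W S k s x : arc_on W S k -> uniq s -> {subset s <= S} ->
  (k < size s)%N -> x \in W -> (forall c, c \in s -> ev x c = 0) -> x = 0.
Proof.
move=> aW us sS ks xW xs; apply/eqP; apply: contraTT ks => x0; rewrite -leqNgt.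
exact: leq_trans (zeros_ge us sS xs) (aW x xW x0).
Qed.

Lemma dual_vector W S k c s : arc_on W S k -> \dim W = k.+1 -> uniq (c :: s) ->
  {subset c :: s <= S} -> size s = k ->
  exists e, [/\ e \in W, ev e c = 1 & forall d, d \in s -> ev e d = 0].
Proof.
move=> aW dW us sS ss.
have [z [zW z0 zs]] : exists z, [/\ z \in W, z != 0 & forall d, d \in s -> ev z d = 0].
  by apply: common_zero; rewrite dW ss.
have zc : ev z c != 0.
  apply: contra z0 => /eqP zc; apply/eqP; apply: (arc_eq0 aW us sS) => //=.
    by rewrite ss.
  by move=> d; rewrite inE => /predU1P[->//|/zs].
exists ((ev z c)^-1 *: z); split; first exact: memvZ.
  by rewrite evZ mulVf.
by move=> d /zs ds; rewrite evZ ds mulr0.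
Qed.

Lemma card_setD1 S c : c \in S -> #|S| = #|S :\ c|.+1.
Proof. by move=> cS; rewrite (cardsD1 c) cS. Qed.

Lemma zeros_setD1 S c x : c \in S -> ev x c = 0 -> zeros S x = (zeros (S :\ c) x).+1.
Proof.
move=> cS xc; rewrite /zeros (cardsD1 c) inE cS xc eqxx add1n; congr _.+1.
by apply: eq_card => d; rewrite !inE andbA.
Qed.

Lemma arc_slice W S k c : arc_on W S k.+1 -> c \in S -> arc_on (W :&: kernel c) (S :\ c) k.
Proof.
move=> aW cS x; rewrite memv_cap mem_kernel => /andP[xW /eqP xc] x0.
by have := aW _ xW x0; rewrite (zeros_setD1 cS xc).
Qed.

Lemma dim_slice W S k c : arc_on W S k.+1 -> \dim W = k.+2 -> c \in S ->
  (k.+1 < #|S|)%N -> \dim (W :&: kernel c) = k.+1.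
Proof.
move=> aW dW cS kS; apply/eqP; rewrite eqn_leq; apply/andP; split; last first.
  by have := dim_cap_kernel W c; rewrite dW.
rewrite leqNgt; apply/negP => dk.
have kS' : (k.+1 <= #|S :\ c|)%N by rewrite -ltnS -card_setD1.
have [z [zW z0]] := many_zeros dk kS'.
by move/leq_trans => /(_ _ (arc_slice aW cS zW z0)); rewrite ltnn.
Qed.

(** Words of a slice [x0 + ker c] agree at [c], which accounts for one of the
coordinates in which they may agree. *)
Lemma new_column_slice W S k c g x0 : new_column W S k.+1 g -> c \in S ->
  x0 \in W -> new_column (W :&: kernel c) (S :\ c) k (fun x => g (x0 + x)).
Proof.
move=> gW cS x0W x y; rewrite !memv_cap !mem_kernel => /andP[xW /eqP xc] /andP[yW /eqP yc].
move=> xy gxy; have xyc : ev (x - y) c = 0 by rewrite evB xc yc subrr.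
have := gW (x0 + x) (x0 + y) (memvD x0W xW) (memvD x0W yW) _ gxy.
rewrite (inj_eq (addrI x0)) => /(_ xy).
by rewrite opprD addrACA subrr add0r (zeros_setD1 cS xyc).
Qed.

(** * A new column is constant along a hyperplane *)
Definition periodic W g z := forall x, x \in W -> g (x + z) = g x :> F.

Lemma new_column_period W S k g z : new_column W S k g -> z \in W -> z != 0 ->
  g z = g 0 -> (zeros S z < k)%N.
Proof. by move=> gW zW z0 gz; have := gW z 0 zW (mem0v W) z0 gz; rewrite subr0. Qed.

(* the number of slopes that forces a function to be affine *)
Variable B : nat.
Hypothesis affine_of_few_slopes : forall f : F -> F, (#|slopes f| <= B)%N ->
  exists a, forall u, f u = f 0 + u * a.

(** In coordinates given by two functionals of [S], the level set of value [v] is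
the graph of a function [f v].  Each functional of [S] other than the first
coordinate vanishes on one direction, whose slope [mu c] is not a slope of [f v];
so [f v] is affine.  The level sets being disjoint, these lines are parallel. *)
Lemma plane_periods W S g : \dim W = 2 -> arc_on W S 1 -> new_column W S 1 g ->
  (#|F| + 1 <= #|S| + B)%N -> (1 < #|S|)%N ->
  exists2 H : {vspace 'rV[F]_n}, (H <= W)%VS /\ \dim H = 1%N &
    forall z, z \in H -> periodic W g z.
Proof.
move=> dW aW gW SB /card_gt1P[c0 [c1 [c0S c1S c01]]].
have [e0 [e0W e00 e01]] : exists e,
    [/\ e \in W, ev e c0 = 1 & forall d, d \in [:: c1] -> ev e d = 0].
  apply: (dual_vector aW dW) => //=; first by rewrite inE c01.
  by move=> d; rewrite !inE => /orP[] /eqP->.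
have [e1 [e1W e11 e10]] : exists e,
    [/\ e \in W, ev e c1 = 1 & forall d, d \in [:: c0] -> ev e d = 0].
  apply: (dual_vector aW dW) => //=; first by rewrite inE eq_sym c01.
  by move=> d; rewrite !inE => /orP[] /eqP->.
move: {e01}(e01 _ (mem_head _ _)) {e10}(e10 _ (mem_head _ _)) => e01 e10.
pose pt a b := a *: e0 + b *: e1.
have ptW a b : pt a b \in W by rewrite memvD ?memvZ.
have ev_pt a b c : ev (pt a b) c = a * ev e0 c + b * ev e1 c by rewrite evD !evZ.
have ptB a b a' b' : pt a b - pt a' b' = pt (a - a') (b - b').
  by rewrite /pt !scalerBl opprD addrACA.
have ptE x : x \in W -> x = pt (ev x c0) (ev x c1).
  move=> xW; apply/eqP; rewrite -subr_eq0; apply/eqP.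
  apply: (arc_eq0 (s := [:: c0; c1]) aW) => //=; first by rewrite inE c01.
  - by move=> d; rewrite !inE => /orP[] /eqP->.
  - by rewrite memvB.
  - move=> d; rewrite !inE => /orP[] /eqP->; rewrite evB ev_pt.
      by rewrite e00 e10 mulr1 mulr0 addr0 subrr.
    by rewrite e01 e11 mulr1 mulr0 add0r subrr.
have pt0 a b : pt a b = 0 -> a = 0 /\ b = 0.
  move=> e; have := ev_pt a b c0; have := ev_pt a b c1.
  by rewrite e !ev0 e00 e01 e10 e11 !mulr1 !mulr0 addr0 add0r => -> ->.
have one_zero z c : c \in S -> ev z c = 0 -> (0 < zeros S z)%N.
  by move=> cS zc; apply/card_gt0P; exists c; rewrite inE cS zc eqxx.
have g_neq a b a' b' c : c \in S -> pt a b != pt a' b' -> ev (pt a b - pt a' b') c = 0 ->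
    g (pt a b) != g (pt a' b').
  move=> cS ne z; apply/eqP => /(gW _ _ (ptW _ _) (ptW _ _) ne).
  by rewrite ltnNge (one_zero _ c).
have ginj a : injective (fun b => g (pt a b)).
  move=> b b' /= e; apply/eqP; apply: contraTT (eqxx (g (pt a b))) => bb'.
  rewrite {2}e; apply: (g_neq _ _ _ _ c0) => //.
    apply: contra bb'; rewrite -subr_eq0 ptB => /eqP/pt0[_ /eqP].
    by rewrite subr_eq0.
  by rewrite ptB ev_pt subrr mul0r e10 mulr0 addr0.
pose f v a := invF (ginj a) v.
have gf v a : g (pt a (f v a)) = v by rewrite /f (f_invF (ginj a)).
have fg a b : f (g (pt a b)) a = b by rewrite /f (invF_f (ginj a)).
pose mu c := - ev e0 c / ev e1 c.
have e1c c : c \in S :\ c0 -> ev e1 c != 0.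
  rewrite !inE => /andP[cc0 cS]; apply/eqP => e1c.
  have e1_0 : e1 = 0.
    apply: (arc_eq0 (s := [:: c; c0]) aW) => //=; first by rewrite inE cc0.
      by move=> d; rewrite !inE => /orP[] /eqP->.
    by move=> d; rewrite !inE => /orP[] /eqP->.
  by move/eqP: e11; rewrite e1_0 ev0 eq_sym oner_eq0.
have mu0 c : c \in S :\ c0 -> ev (pt 1 (mu c)) c = 0.
  by move=> cS; rewrite ev_pt mul1r /mu divfK ?e1c // subrr.
have mu_inj : {in S :\ c0 &, injective mu}.
  move=> c d cS dS e; apply/eqP; apply/negPn/negP => cd.
  have /pt0[/eqP] : pt 1 (mu c) = 0; last by rewrite oner_eq0.
  apply: (arc_eq0 (s := [:: c; d]) aW) => //=; first by rewrite inE cd.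
    move=> a; rewrite !inE => /orP[] /eqP->; [move: cS | move: dS]; rewrite inE; by case/andP.
  by move=> a; rewrite !inE => /orP[] /eqP->; rewrite ?mu0 // e mu0.
have slopes_mu v : slopes (f v) \subset ~: (mu @: (S :\ c0)).
  apply/subsetP => y /slopesP[u [w [uw /eqP]]]; rewrite shear_eq => /eqP e.
  rewrite inE; apply/negP => /imsetP[c cS yE].
  have ptE' : pt u (f v u) - pt w (f v w) = (u - w) *: pt 1 (mu c).
    by rewrite ptB e /pt scalerDr !scalerA mulr1 yE.
  have cS' : c \in S by move: cS; rewrite inE => /andP[].
  have : g (pt u (f v u)) != g (pt w (f v w)).
    apply: (g_neq _ _ _ _ c) => //; last by rewrite ptE' evZ mu0 ?mulr0.
    rewrite -subr_eq0 ptB; apply: contra uw => /eqP/pt0[/eqP].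
    by rewrite subr_eq0.
  by rewrite !gf eqxx.
have affine v : exists a, forall u, f v u = f v 0 + u * a.
  apply: affine_of_few_slopes; apply: leq_trans (subset_leq_card (slopes_mu v)) _.
  rewrite -(leq_add2l #|mu @: (S :\ c0)|) card_field_setC (card_in_imset mu_inj).
  by rewrite -ltnS -addSn -card_setD1 // -addn1.
have [a aE] := affine (g 0).
have affine' v u : f v u = f v 0 + u * a.
  have [a' a'E] := affine v; rewrite a'E; have [->//|aa'] := eqVneq a' a.
  (* the abscissa at which two lines of distinct slopes would meet *)
  pose x0 := (f (g 0) 0 - f v 0) / (a' - a).
  have e : f v x0 = f (g 0) x0.
    have E : x0 * (a' - a) = f (g 0) 0 - f v 0 by rewrite divfK // subr_eq0.
    rewrite a'E aE; apply/eqP; rewrite -subr_eq0.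
    have -> : f v 0 + x0 * a' - (f (g 0) 0 + x0 * a) =
      x0 * (a' - a) - (f (g 0) 0 - f v 0) by ring.
    by rewrite E subrr.
  have vE : v = g 0 by rewrite -(gf v x0) e gf.
  by have := aE 1; rewrite -vE a'E !mul1r => /addrI->.
exists <[pt 1 a]>%VS; first split.
- by rewrite -memvE.
- rewrite dim_vline; case: eqP => // /pt0[/eqP].
  by rewrite oner_eq0.
move=> z /vlineP[u ->] x xW; rewrite (ptE x xW).
set b := ev x c0; set d := ev x c1.
have -> : pt b d + u *: pt 1 a = pt (b + u) (d + u * a).
  by rewrite /pt scalerDr !scalerA mulr1 addrACA -!scalerDl.
have dE := fg b d; rewrite -{1}dE affine'.
have -> : f (g (pt b d)) 0 + b * a + u * a = f (g (pt b d)) (b + u).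
  by rewrite (affine' _ (b + u)); ring.
exact: gf.
Qed.

Lemma dim_add_vector Z v : v \notin Z -> \dim (Z + <[v]>) = (\dim Z).+1.
Proof.
move=> vZ; have v0 : v != 0 by apply: contraNneq vZ => ->; rewrite mem0v.
rewrite dimv_disjoint_sum ?dim_vline ?v0 ?addn1 //.
apply/eqP; rewrite -subv0; apply/subvP => x; rewrite memv_cap memv0.
case/andP=> xZ /vlineP[a xE]; have [a0|a0] := eqVneq a 0.
  by rewrite xE a0 scale0r.
case/negP: vZ; rewrite -[v](scalerK a0) -xE memvZ //.
Qed.

Lemma zerosZ S a z : a != 0 -> zeros S (a *: z) = zeros S z.
Proof.
by move=> a0; apply: eq_card => c; rewrite !inE evZ mulf_eq0 (negPf a0).
Qed.

Lemma periodicD W g z1 z2 : z1 \in W ->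
  periodic W g z1 -> periodic W g z2 -> periodic W g (z1 + z2).
Proof. by move=> z1W p1 p2 x xW; rewrite addrA p2 ?memvD ?p1. Qed.

(** A hyperplane of periods contains every difference of two words with the same
value: it misses some [w] with at least [k] zeros, and together with [w] it spans
[W], while [g] is injective on the translates of the line of [w]. *)
Lemma period_sub W S k g H x u : \dim W = k.+1 -> (k <= #|S|)%N ->
  new_column W S k g -> (H <= W)%VS -> \dim H = k ->
  (forall z, z \in H -> periodic W g z) ->
  x \in W -> u \in W -> g (x + u) = g x -> u \in H.
Proof.
move=> dW kS gW HW dH perH xW uW gxu.
have [|w [wW w0 kw]] := @many_zeros W S k _ kS; first by rewrite dW.
have wH : w \notin H.
  apply/negP => wH; have := new_column_period gW wW w0.
  by have := perH w wH 0 (mem0v W); rewrite add0r => -> /(_ erefl); rewrite ltnNge kw.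
have /eqP HwE : (H + <[w]>)%VS == W.
  by rewrite eqEdim subv_add HW -memvE wW dim_add_vector // dH dW /=.
move: uW; rewrite -{1}HwE => /memv_addP[z zH [v /vlineP[t ->] uE]].
have [t0|t0] := eqVneq t 0; first by rewrite uE t0 scale0r addr0.
have xtW : x + t *: w \in W by rewrite memvD ?memvZ.
have gxt : g (x + t *: w) = g x.
  by rewrite -gxu uE [z + _]addrC addrA (perH z zH).
have := gW _ _ xtW xW _ gxt; rewrite -subr_eq0 addrAC subrr add0r zerosZ //.
by rewrite scaler_eq0 negb_or t0 w0 ltnNge kw => /(_ isT).
Qed.

Hypotheses (B_gt0 : (0 < B)%N) (B_small : (3 * B <= #|F|)%N).
Hypothesis two_neq0 : (2%:R : F) != 0.

Definition columns_periodic k := forall W S g, \dim W = k.+1 -> arc_on W S k ->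
  new_column W S k g -> (#|F| + k <= #|S| + B)%N ->
  exists2 H : {vspace 'rV[F]_n}, (H <= W)%VS /\ \dim H = k &
    forall z, z \in H -> periodic W g z.

Lemma large_card S k : (#|F| + k <= #|S| + B)%N -> (k.+2 <= #|S|)%N.
Proof. by move=> SB; clear -B_gt0 B_small SB; lia. Qed.

(** The statement in dimension one less, applied to a slice [x0 + ker c]. *)
Lemma slice_periods W S g k c x0 : columns_periodic k.+1 -> \dim W = k.+3 ->
  arc_on W S k.+2 -> new_column W S k.+2 g -> (#|F| + k.+2 <= #|S| + B)%N ->
  c \in S -> x0 \in W ->
  exists2 H : {vspace 'rV[F]_n}, (H <= W :&: kernel c)%VS /\ \dim H = k.+1 &
    forall z, z \in H -> forall x, x \in W -> ev x c = ev x0 c -> g (x + z) = g x.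
Proof.
move=> IH dW aW gW SB cS x0W.
have kS := large_card SB.
have [|H [HW dH] perH] := IH _ _ _ (dim_slice aW dW cS (ltnW kS)) (arc_slice aW cS)
  (new_column_slice gW cS x0W).
  by move: SB; rewrite (card_setD1 cS) addnS addSn.
exists H => // z zH x xW xc.
have xx0 : x - x0 \in (W :&: kernel c)%VS.
  by rewrite memv_cap memvB //= mem_kernel evB xc subrr.
have xE : x0 + (x - x0) = x by rewrite addrC subrK.
by have := perH z zH _ xx0; rewrite addrA xE.
Qed.

(** Moving inside the level set of [g 0], the slices by [c1] and [c2] provide two
families of lines.  Comparing the two ways around a parallelogram shows that their
slopes vary linearly, with a common coefficient [gam]: the level set is a graph
[z = b0' x + b0 y + gam x y].  The slice by [c0] provides a third family, which
forces [gam = 0]. *)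
Lemma space_periods : columns_periodic 1 -> columns_periodic 2.
Proof.
move=> P1 W S g dW aW gW SB.
have /card_gt2P[c0 [c1 [c2 [[c0S c1S c2S] [c01 c12 c20]]]]] := ltnW (large_card SB).
have inS3 d : d \in [:: c0; c1; c2] -> d \in S.
  by rewrite !inE => /or3P[] /eqP->.
have dual a b c : uniq [:: a; b; c] -> {subset [:: a; b; c] <= S} ->
    exists e, [/\ e \in W, ev e a = 1, ev e b = 0 & ev e c = 0].
  move=> u sS; have [e [eW ea e0]] := dual_vector aW dW u sS erefl.
  by exists e; split=> //; apply: e0; rewrite !inE eqxx ?orbT.
have nc0 : c0 != c2 by rewrite eq_sym.
have [e0 [e0W e00 e01 e02]] : exists e, [/\ e \in W, ev e c0 = 1, ev e c1 = 0 & ev e c2 = 0].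
  by apply: dual; [rewrite /= !inE negb_or c01 nc0 c12 | exact: inS3].
have [e1 [e1W e11 e10 e12]] : exists e, [/\ e \in W, ev e c1 = 1, ev e c0 = 0 & ev e c2 = 0].
  apply: dual; first by rewrite /= !inE negb_or c12 nc0 eq_sym c01.
  by move=> d; rewrite !inE => /or3P[] /eqP->.
have [e2 [e2W e22 e20 e21]] : exists e, [/\ e \in W, ev e c2 = 1, ev e c0 = 0 & ev e c1 = 0].
  apply: dual; first by rewrite /= !inE negb_or c20 c01 eq_sym c12.
  by move=> d; rewrite !inE => /or3P[] /eqP->.
have evE := (evD, evZ, e00, e01, e02, e10, e11, e12, e20, e21, e22,
             mulr1, mulr0, addr0, add0r).
have two_zeros z c d : c \in S -> d \in S -> c != d -> ev z c = 0 -> ev z d = 0 ->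
    (1 < zeros S z)%N.
  move=> cS dS cd zc zd; rewrite (zeros_setD1 cS zc) (zeros_setD1 _ zd) //.
  by rewrite !inE eq_sym cd.
have same x y c d : x \in W -> y \in W -> c \in S -> d \in S -> c != d ->
    ev x c = ev y c -> ev x d = ev y d -> g x = g y -> x = y.
  move=> xW yW cS dS cd xc xd gxy; apply/eqP/negPn/negP => xy.
  have := gW _ _ xW yW xy gxy; rewrite ltnNge (two_zeros _ c d) //.
    by rewrite evB xc subrr.
  by rewrite evB xd subrr.
have slide c b d eb ed x0 : uniq [:: c; b; d] -> {subset [:: c; b; d] <= S} ->
    eb \in W -> ed \in W -> x0 \in W ->
    [/\ ev eb c = 0, ev eb b = 1 & ev eb d = 0] ->
    [/\ ev ed c = 0, ev ed b = 0 & ev ed d = 1] ->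
    exists beta, beta != 0 /\ forall x t, x \in W -> ev x c = ev x0 c ->
      g (x + t *: (ed + beta *: eb)) = g x.
  move=> u sS ebW edW x0W [ebc ebb ebd] [edc edb edd].
  have cS : c \in S by apply: sS; rewrite mem_head.
  have bS : b \in S by apply: sS; rewrite !inE eqxx ?orbT.
  have dS : d \in S by apply: sS; rewrite !inE eqxx ?orbT.
  move: (u); rewrite /= !inE negb_or andbT => /andP[/andP[cb cd] bd].
  have [H [HW dH] perH] := slice_periods P1 dW aW gW SB cS x0W.
  have [v [vH v0]] : exists v, v \in H /\ v != 0.
    by exists (vpick H); rewrite memv_pick vpick0 -dimv_eq0 dH.
  have := subvP HW v vH; rewrite memv_cap mem_kernel => /andP[vW /eqP vc].
  have gxv : g (x0 + v) = g x0 by apply: perH.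
  have x0vW : x0 + v \in W by rewrite memvD.
  have vnz e : e \in S -> c != e -> ev v e != 0.
    move=> eS ce; apply: contra v0 => /eqP ve; apply/eqP.
    have : x0 + v = x0 by apply: (same _ _ c e) => //; rewrite evD ?vc ?ve addr0.
    by move/eqP; rewrite -subr_eq0 addrAC subrr add0r => /eqP.
  pose beta := ev v b / ev v d; exists beta.
  have vd := vnz d dS cd; have vb := vnz b bS cb.
  have vE : (ev v d)^-1 *: v = ed + beta *: eb.
    apply/eqP; rewrite -subr_eq0; apply/eqP; apply: (arc_eq0 aW u sS) => //.
      by rewrite memvB ?memvD ?memvZ.
    move=> e; rewrite !inE evB !evD !evZ => /or3P[] /eqP->.
    - by rewrite vc edc ebc !mulr0 addr0 subrr.
    - by rewrite edb ebb mulr1 add0r /beta mulrC subrr.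
    - by rewrite edd ebd mulVf // mulr0 addr0 subrr.
  split; first by rewrite mulf_neq0 // invr_eq0.
  by move=> x t xW xc; apply: perH => //; rewrite -vE !memvZ.
have slide1 x0 : x0 \in W -> exists beta, beta != 0 /\ forall x t, x \in W ->
    ev x c1 = ev x0 c1 -> g (x + t *: (e2 + beta *: e0)) = g x.
  move=> x0W; apply: (slide c1 c0 c2) => //.
    by rewrite /= !inE negb_or c12 nc0 eq_sym c01.
  by move=> d; rewrite !inE => /or3P[] /eqP->.
have slide2 x0 : x0 \in W -> exists beta, beta != 0 /\ forall x t, x \in W ->
    ev x c2 = ev x0 c2 -> g (x + t *: (e1 + beta *: e0)) = g x.
  move=> x0W; apply: (slide c2 c0 c1) => //.
    by rewrite /= !inE negb_or c20 c01 eq_sym c12.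
  by move=> d; rewrite !inE => /or3P[] /eqP->.
have [b0 [_ b0P]] := slide1 0 (mem0v W).
have [b0' [_ b0'P]] := slide2 0 (mem0v W).
have [m [m0 mP]] : exists beta, beta != 0 /\ forall x t, x \in W ->
    ev x c0 = ev 0 c0 -> g (x + t *: (e1 + beta *: e2)) = g x.
  apply: (slide c0 c2 c1) => //; last exact: mem0v.
    by rewrite /= !inE negb_or c01 nc0 eq_sym c12.
  by move=> d; rewrite !inE => /or3P[] /eqP->.
(* the two paths around a parallelogram in the level set of g 0 *)
have square a b beta beta' :
    (forall x t, x \in W -> ev x c1 = a -> g (x + t *: (e2 + beta *: e0)) = g x) ->
    (forall x t, x \in W -> ev x c2 = b -> g (x + t *: (e1 + beta' *: e0)) = g x) ->
    b0 * b + beta' * a = b0' * a + beta * b.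
  move=> v1 v2.
  have u1W : b *: (e2 + b0 *: e0) \in W by rewrite !memvZ ?memvD ?memvZ.
  have u2W : a *: (e1 + b0' *: e0) \in W by rewrite !memvZ ?memvD ?memvZ.
  have g1 : g (b *: (e2 + b0 *: e0)) = g 0.
    by rewrite -[in LHS](add0r (b *: _)) b0P ?mem0v.
  have g2 : g (a *: (e1 + b0' *: e0)) = g 0.
    by rewrite -[in LHS](add0r (a *: _)) b0'P ?mem0v.
  have g12 := v2 _ a u1W _; rewrite {}g1 in g12.
  have g21 := v1 _ b u2W _; rewrite {}g2 in g21.
  have E : b *: (e2 + b0 *: e0) + a *: (e1 + beta' *: e0) =
           a *: (e1 + b0' *: e0) + b *: (e2 + beta *: e0).
    apply: (same _ _ c1 c2) => //; try by rewrite !(memvD, memvZ).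
    - by rewrite !evE.
    - by rewrite !evE.
    - by rewrite g12 ?g21 ?evE.
  have := congr1 (ev ^~ c0) E; rewrite !evE.
  by rewrite [b * b0]mulrC [a * beta']mulrC [a * b0']mulrC [b * beta]mulrC.
have [beta1 [_ beta1P]] := slide1 e1 e1W.
pose gam := beta1 - b0.
have slide2E b beta' :
    (forall x t, x \in W -> ev x c2 = b -> g (x + t *: (e1 + beta' *: e0)) = g x) ->
    beta' = b0' + gam * b.
  move=> v2; have := square 1 b beta1 beta' _ v2; rewrite e11 in beta1P.
  by move/(_ beta1P) => E; apply: (@addrI _ (b0 * b)); rewrite -[beta']mulr1 E /gam; ring.
have slide1E a beta :
    (forall x t, x \in W -> ev x c1 = a -> g (x + t *: (e2 + beta *: e0)) = g x) ->
    beta = b0 + gam * a.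
  move=> v1; have [beta' [_ v2]] := slide2 e2 e2W; rewrite e22 in v2.
  have := square a 1 beta beta' v1 v2; rewrite (slide2E _ _ v2) => E.
  apply: (@addrI _ (b0' * a)); rewrite -[beta]mulr1 -E; ring.
(* the line along e1 + m e2 lies in the level set, for every parameter t *)
have gam0 : gam = 0.
  have E t : b0 * (t * m) + (b0' + gam * (t * m)) * t = 0.
    have [beta' [_ v2]] := slide2 ((t * m) *: e2) (memvZ _ e2W).
    have v2' : forall x u, x \in W -> ev x c2 = t * m ->
        g (x + u *: (e1 + beta' *: e0)) = g x.
      by move=> x u xW xc; apply: v2; rewrite ?evE.
    have := slide2E _ _ v2' => <-.
    have uW : (t * m) *: (e2 + b0 *: e0) \in W by rewrite !memvZ ?memvD ?memvZ.
    have g1 : g ((t * m) *: (e2 + b0 *: e0)) = g 0.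
      by rewrite -[in LHS](add0r (_ *: _)) b0P ?mem0v.
    have g2 : g (t *: (e1 + m *: e2)) = g 0.
      by rewrite -[in LHS](add0r (_ *: _)) mP ?mem0v.
    have g12 := v2' _ t uW _; rewrite {}g1 in g12.
    have Ept : (t * m) *: (e2 + b0 *: e0) + t *: (e1 + beta' *: e0) = t *: (e1 + m *: e2).
      apply: (same _ _ c1 c2) => //; try by rewrite !(memvD, memvZ).
      - by rewrite !evE.
      - by rewrite !evE.
      - by rewrite g12 ?g2 ?evE.
    by have := congr1 (ev ^~ c0) Ept; rewrite !evE [_ * b0]mulrC [t * beta']mulrC.
  have : 2%:R * (gam * m) = 0.
    (* the parameters 1 and -1 cancel all terms but the quadratic one *)
    by rewrite -[RHS](addr0 0) -{1}(E 1) -(E (-1)); ring.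
  by move/eqP; rewrite !mulf_eq0 (negPf two_neq0) (negPf m0) orbF => /eqP.
have perZ z t : z = e1 + b0' *: e0 \/ z = e2 + b0 *: e0 -> periodic W g (t *: z).
  case=> -> x xW.
    have [beta' [_ v2]] := slide2 x xW.
    by have := v2 x t xW erefl; rewrite (slide2E _ _ v2) gam0 mul0r addr0.
  have [beta' [_ v1]] := slide1 x xW.
  by have := v1 x t xW erefl; rewrite (slide1E _ _ v1) gam0 mul0r addr0.
have u1W : e1 + b0' *: e0 \in W by rewrite memvD ?memvZ.
have u2W : e2 + b0 *: e0 \in W by rewrite memvD ?memvZ.
exists (<[e1 + b0' *: e0]> + <[e2 + b0 *: e0]>)%VS; first split.
- by rewrite subv_add -!memvE u1W u2W.
- rewrite dim_add_vector ?dim_vline; last first.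
    apply/negP => /vlineP[t /(congr1 (ev ^~ c2))]; rewrite !evE => /eqP.
    by rewrite oner_eq0.
  case: eqP => // /(congr1 (ev ^~ c1)); rewrite !evE ev0 => /eqP.
  by rewrite oner_eq0.
move=> z /memv_addP[z1 /vlineP[t1 ->] [z2 /vlineP[t2 ->] ->]].
by apply: periodicD; rewrite ?memvZ //; apply: perZ; [left | right].
Qed.

(** A period of one slice by [a] that is killed by [b] is a period of [g] on [W]:
the slice by [b] through any [x] contains some [y] with [ev y a = 0], and [g] takes
the same value at [y] and at its translate, which by [period_sub] makes the
translation a period of this slice.  With three functionals, three hyperplane
sections of spaces of slice periods thus consist of periods of [g].  Not all of
their elements are killed by [c1], [c2] and [c3], since these would have too many
zeros; hence together they span dimension [m + 3]. *)
Lemma higher_periods m : columns_periodic m.+2 -> columns_periodic m.+3.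
Proof.
move=> IH W S g dW aW gW SB; have kS := large_card SB.
have /card_gt2P[c1 [c2 [c3 [[c1S c2S c3S] [c12 c23 c31]]]]] : (2 < #|S|)%N by lia.
have dual a b : a \in S -> b \in S -> a != b ->
    exists e, [/\ e \in W, ev e a = 1 & ev e b = 0].
  move=> aS bS ab; have aS' : a \in S :\ b by rewrite !inE ab.
  have [||z [zW z0 kz]] := @many_zeros (W :&: kernel b) (S :\ b :\ a) m.+2.
  - by rewrite (dim_slice aW dW bS) // ltnW // ltnW.
  - by rewrite -ltnS -card_setD1 // -ltnS -card_setD1 // ltnW.
  move: (zW); rewrite memv_cap mem_kernel => /andP[zW' /eqP zb].
  have za : ev z a != 0.
    apply/eqP => za; have := aW z zW' z0; rewrite (zeros_setD1 bS zb).
    by rewrite (zeros_setD1 aS' za) ltnS ltnNge kz.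
  exists ((ev z a)^-1 *: z); rewrite memvZ // !evZ mulVf // zb mulr0.
  by split.
have dualW a b u v : a \in S -> b \in S -> a != b -> exists z,
    [/\ z \in W, ev z a = u & ev z b = v].
  move=> aS bS ab; have [e [eW ea eb]] := dual _ _ aS bS ab.
  have [|e' [e'W e'b e'a]] := dual _ _ bS aS _; first by rewrite eq_sym.
  exists (u *: e + v *: e'); rewrite memvD ?memvZ // !evD !evZ ea eb e'a e'b.
  by rewrite !mulr1 !mulr0 addr0 add0r.
have sliceP a x0 : a \in S -> x0 \in W -> exists H : {vspace 'rV[F]_n},
    [/\ (H <= W :&: kernel a)%VS, \dim H = m.+2 &
    forall z, z \in H -> forall x, x \in W -> ev x a = ev x0 a -> g (x + z) = g x].
  by move=> aS x0W; have [H [? ?] ?] := slice_periods IH dW aW gW SB aS x0W; exists H.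
have spread a b H z : a \in S -> b \in S -> a != b -> z \in W -> 
    (forall x, x \in W -> ev x a = 0 -> g (x + z) = g x) -> ev z a = 0 -> ev z b = 0 ->
    periodic W g z.
  move=> aS bS ab zW zP za zb x xW.
  have [y [yW ya yb]] := dualW a b 0 (ev x b) aS bS ab.
  have [H' [H'W dH' perH']] := sliceP b x bS xW.
  apply: (perH' z _ x) => //; set V := (W :&: kernel b)%VS in H'W.
  have dV : \dim V = m.+3 by rewrite (dim_slice aW dW bS) // ltnW // ltnW.
  have gV : new_column V (S :\ b) m.+2 (fun u => g (x + u)) by apply: new_column_slice.
  apply: (period_sub dV _ gV H'W dH' _ (x := y - x)) => //.
  - by rewrite -ltnS -card_setD1 // ltnW // ltnW.
  - move=> h hH u; rewrite memv_cap mem_kernel => /andP[uW /eqP ub].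
    by rewrite addrA (perH' h hH) ?memvD // evD ub addr0.
  - by rewrite memv_cap memvB //= mem_kernel evB yb subrr.
  - by rewrite memv_cap zW mem_kernel zb eqxx.
  - by rewrite addrA ![x + (y - x)]addrC subrK zP.
have [H1 [H1W dH1 perH1]] := sliceP c1 0 c1S (mem0v W).
have [H2 [H2W dH2 perH2]] := sliceP c2 0 c2S (mem0v W).
have memH1 z : z \in H1 -> z \in W /\ ev z c1 = 0.
  by move/(subvP H1W); rewrite memv_cap mem_kernel => /andP[? /eqP].
have memH2 z : z \in H2 -> z \in W /\ ev z c2 = 0.
  by move/(subvP H2W); rewrite memv_cap mem_kernel => /andP[? /eqP].
pose A := (H1 :&: kernel c2)%VS; pose D := (H1 :&: kernel c3)%VS.
pose E := (H2 :&: kernel c3)%VS.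
have c13 : c1 != c3 by rewrite eq_sym.
have perA z : z \in A -> z \in W /\ periodic W g z.
  rewrite memv_cap mem_kernel => /andP[zH /eqP zc]; have [zW z1] := memH1 z zH.
  split=> //; apply: (spread c1 c2) => // x xW x1.
  by apply: perH1 => //; rewrite ev0.
have perD z : z \in D -> z \in W /\ periodic W g z.
  rewrite memv_cap mem_kernel => /andP[zH /eqP zc]; have [zW z1] := memH1 z zH.
  split=> //; apply: (spread c1 c3) => // x xW x1.
  by apply: perH1 => //; rewrite ev0.
have perE z : z \in E -> z \in W /\ periodic W g z.
  rewrite memv_cap mem_kernel => /andP[zH /eqP zc]; have [zW z1] := memH2 z zH.
  split=> //; apply: (spread c2 c3) => // x xW x1.
  by apply: perH2 => //; rewrite ev0.
have three_zeros Z : (m < \dim Z)%N -> (forall z, z \in Z -> z \in W /\ periodic W g z) ->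
    (forall z, z \in Z -> [/\ ev z c1 = 0, ev z c2 = 0 & ev z c3 = 0]) -> False.
  move=> dZ perZ Z0; have c2S' : c2 \in S :\ c1 by rewrite !inE eq_sym c12.
  have c3S' : c3 \in S :\ c1 :\ c2 by rewrite !inE c31 eq_sym c23.
  have [|z [zZ z0 kz]] := @many_zeros Z (S :\ c1 :\ c2 :\ c3) m dZ.
  - rewrite -ltnS -card_setD1 // -ltnS -card_setD1 // -ltnS -card_setD1 //.
    by rewrite ltnW // ltnW.
  have [zW perz] := perZ z zZ; have [z1 z2 z3] := Z0 z zZ.
  have := new_column_period gW zW z0; rewrite -{1}[z]add0r perz ?mem0v // => /(_ erefl).
  rewrite (zeros_setD1 c1S z1) (zeros_setD1 c2S' z2) (zeros_setD1 c3S' z3).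
  by rewrite !ltnS ltnNge kz.
have dA : (m < \dim A)%N by have := dim_cap_kernel H1 c2; rewrite dH1.
have dD : (m < \dim D)%N by have := dim_cap_kernel H1 c3; rewrite dH1.
have dE : (m < \dim E)%N by have := dim_cap_kernel H2 c3; rewrite dH2.
have [d dD2 d2] : exists2 d, d \in D & ev d c2 != 0.
  have [/subvP DA|/subvPn[d dD2 d2]] := boolP (D <= kernel c2)%VS; last first.
    by exists d; rewrite // -mem_kernel.
  case: (three_zeros D) => // z zD; have := DA z zD; rewrite mem_kernel => /eqP z2.
  by move: zD; rewrite memv_cap mem_kernel => /andP[/memH1[_ ?] /eqP].
have [e eE e1] : exists2 e, e \in E & ev e c1 != 0.
  have [/subvP EA|/subvPn[e eE e1]] := boolP (E <= kernel c1)%VS; last first.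
    by exists e; rewrite // -mem_kernel.
  case: (three_zeros E) => // z zE; have := EA z zE; rewrite mem_kernel => /eqP z2.
  by move: zE; rewrite memv_cap mem_kernel => /andP[/memH2[_ ?] /eqP].
have perH z : z \in (A + <[d]> + <[e]>)%VS -> z \in W /\ periodic W g z.
  have [dW' perd] := perD _ dD2; have [eW' pere] := perE _ eE.
  case/memv_addP=> y /memv_addP[x /perA[xW perx] [y' yd ->]] [z' ze ->].
  have [y'W pery] : y' \in W /\ periodic W g y'.
    by apply: perD; apply: subvP yd; rewrite -memvE.
  have [z'W perz] : z' \in W /\ periodic W g z'.
    by apply: perE; apply: subvP ze; rewrite -memvE.
  split; first by rewrite !memvD.
  by apply: periodicD; rewrite ?memvD //; apply: periodicD.
have dH : (m.+3 <= \dim (A + <[d]> + <[e]>))%N.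
  rewrite dim_add_vector ?dim_add_vector //.
    by apply: contra d2; rewrite memv_cap mem_kernel => /andP[].
  apply: contra e1 => /memv_addP[x xA [y yd ->]]; rewrite evD.
  have [_ ->] : x \in W /\ ev x c1 = 0 by apply: memH1; case/memv_capP: xA.
  have [_ ->] : y \in W /\ ev y c1 = 0; last by rewrite addr0.
  apply: memH1; apply: subvP yd; rewrite -memvE.
  by case/memv_capP: dD2.
exists (A + <[d]> + <[e]>)%VS; last by move=> z /perH[].
split; first by apply/subvP => z /perH[].
apply/eqP; rewrite eqn_leq dH andbT leqNgt; apply/negP => dH'.
have [z [zZ z0 kz]] := many_zeros dH' (ltnW (ltnW kS)).
have [zW perz] := perH z zZ.
have := new_column_period gW zW z0; rewrite -{1}[z]add0r perz ?mem0v // => /(_ erefl).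
by rewrite ltnNge kz.
Qed.

Theorem all_columns_periodic k : columns_periodic k.+1.
Proof.
elim: k => [|[|k] IH]; last exact: higher_periods.
  move=> W S g dW aW gW SB; apply: (plane_periods dW aW gW SB).
  exact: ltnW (large_card SB).
exact: space_periods.
Qed.

End Functionals.

(** * Weighted sums over a pencil *)

Section Pencil.
Local Open Scope ring_scope.
Variables (F : finFieldType) (I : finType).
Implicit Types (S T J : {set I}) (y : I -> F).

Lemma prod_nonzero_sqr : (\prod_(b : F | b != 0) b) ^+ 2 = 1.
Proof.
rewrite expr2 {2}(reindex_inj (@invr_inj F)) /=.
rewrite [X in _ * X](eq_bigl (fun b => b != 0)) => [|b]; last by rewrite invr_eq0.
by rewrite -big_split big1 //= => b b0; rewrite divff.
Qed.

(** The value at [y X] of the derivative of the polynomial with roots [y W]. *)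
Definition vdm T y X := \prod_(W in T :\ X) (y X - y W).

Lemma vdm_neq0 T y X : {in T &, injective y} -> X \in T -> vdm T y X != 0.
Proof.
move=> yinj XT; apply/prodf_neq0 => W; rewrite !inE => /andP[WX WT].
by rewrite subr_eq0; apply: contra WX => /eqP/(yinj _ _ XT WT)->.
Qed.

Definition missing T y : {poly F} := \prod_(b in ~: (y @: T)) ('X - b%:P).

(** The two factors together run over the differences of [y X] with all other
elements of the field, and the product of the nonzero elements has square [1]. *)
Lemma vdm_missing T y X : {in T &, injective y} -> X \in T ->
  (vdm T y X * (missing T y).[y X]) ^+ 2 = 1.
Proof.
move=> yinj XT; rewrite -prod_nonzero_sqr; congr (_ ^+ 2).
have -> : vdm T y X = \prod_(b in y @: T | b != y X) (y X - b).
  rewrite big_imset_cond //=; apply: eq_bigl => W; rewrite !inE andbC.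
  case WT: (W \in T) => //=; congr (~~ _).
  by apply/eqP/eqP => [->//|/(yinj _ _ WT XT)].
rewrite /missing horner_prod [RHS](reindex_inj (@subrI F (y X))) /=.
rewrite [RHS](bigID (mem (y @: T))) /=; congr (_ * _).
  by apply: eq_bigl => b; rewrite subr_eq0 eq_sym andbC.
rewrite (eq_bigr (fun b => y X - b)) => [|b _]; last by rewrite hornerXsubC.
apply: eq_bigl => b; rewrite !inE subr_eq0 andbC.
case bT: (b \in _) => //=; apply/esym; apply: contraFneq bT => <-.
exact: imset_f.
Qed.

Lemma size_missing T y : {in T &, injective y} ->
  size (missing T y) = (#|F| - #|T|).+1.
Proof.
move=> yinj; rewrite /missing -big_enum /= size_prod_XsubC -cardE.
by rewrite -(card_field_setC (y @: T)) card_in_imset // addKn.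
Qed.

Lemma missing_monic T y : missing T y \is monic.
Proof. exact: monic_prod_XsubC. Qed.

(** The leading coefficient in Lagrange's interpolation formula. *)
Lemma lagrange_coef J y (f : {poly F}) : {in J &, injective y} ->
  (size f <= #|J|)%N ->
  \sum_(X in J) f.[y X] / vdm J y X = f`_(#|J|).-1.
Proof.
move=> yinj sf; pose L X := \prod_(W in J :\ X) ('X - (y W)%:P).
have LX X : (L X).[y X] = vdm J y X.
  by rewrite horner_prod; apply: eq_bigr => W _; rewrite hornerXsubC.
have LY X Y : X \in J -> Y \in J -> Y != X -> (L X).[y Y] = 0.
  move=> XJ YJ YX; rewrite horner_prod (bigD1 Y) /=; last by rewrite !inE YX.
  by rewrite hornerXsubC subrr mul0r.
have sL X : X \in J -> size (L X) = #|J|.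
  by move=> XJ; rewrite /L -big_enum /= size_prod_XsubC -cardE [RHS](cardsD1 X) XJ.
have lL X : X \in J -> (L X)`_(#|J|).-1 = 1.
  move=> XJ; have := monic_prod_XsubC (index_enum I) (mem (J :\ X)) y.
  by rewrite monicE lead_coefE -/(L X) sL // => /eqP.
have fE : f = \sum_(X in J) (f.[y X] / vdm J y X) *: L X.
  apply/eqP; rewrite -subr_eq0; apply/eqP; set D := f - _.
  have sD : (size D <= #|y @: J|)%N.
    rewrite (card_in_imset yinj); apply: leq_trans (size_polyD _ _) _.
    rewrite geq_max sf size_polyN; apply: leq_trans (size_sum _ _ _) _.
    apply/bigmax_leqP => X XJ; apply: leq_trans (size_scale_leq _ _) _.
    by rewrite sL.
  apply: poly_eq0_card sD _ => _ /imsetP[Y YJ ->].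
  rewrite /D hornerD hornerN horner_sum (bigD1 Y) //= big1 => [|X /andP[XJ XY]].
    by rewrite addr0 hornerZ LX divfK ?subrr // vdm_neq0.
  by rewrite hornerZ LY ?mulr0 // eq_sym.
rewrite [in RHS]fE coef_sum; apply: eq_bigr => X XJ.
by rewrite coefZ lL ?mulr1.
Qed.

(** By [vdm_missing], inverting the square amounts to evaluating the square of the
monic polynomial [missing], of degree [2 (q - #|S|)]. *)
Lemma sum_inv_vdm S J y : {in S &, injective y} -> J \subset S ->
  (2 * (#|F| - #|S|) < #|J|)%N ->
  \sum_(X in J) (vdm S y X ^+ 2 * vdm J y X)^-1 =
    (#|J| == (2 * (#|F| - #|S|)).+1)%:R.
Proof.
move=> yinj /subsetP JS sJ; have yinjJ : {in J &, injective y}.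
  by move=> X Y /JS XS /JS YS; apply: yinj.
pose A := missing S y ^+ 2.
have Amonic : A \is monic by rewrite monic_exp // missing_monic.
have sA : size A = (2 * (#|F| - #|S|)).+1.
  rewrite (polySpred (monic_neq0 Amonic)) size_exp size_missing //=.
  by rewrite mulnC.
have -> : \sum_(X in J) (vdm S y X ^+ 2 * vdm J y X)^-1 =
          \sum_(X in J) A.[y X] / vdm J y X.
  apply: eq_bigr => X XJ; rewrite invfM; congr (_ / _).
  have := vdm_missing yinj (JS _ XJ); rewrite exprMn /A horner_exp => E.
  have v0 : vdm S y X ^+ 2 != 0 by rewrite expf_neq0 // vdm_neq0 ?JS.
  by apply: (mulfI v0); rewrite E divff.
rewrite lagrange_coef ?sA //.
have [JE|JE] := eqVneq.
  by move: Amonic; rewrite monicE lead_coefE sA JE => /eqP.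
rewrite nth_default // sA; move: sJ JE; rewrite leq_eqVlt eq_sym => /orP[->//|].
by case: #|J|.
Qed.

(** The functionals other than a given [X] are seen as points of a projective line,
the pencil of [X]; [br Y W] is the determinant of [X], [Y] and [W], while [r] and
[beta] are the determinants with [X] and two fixed points [R], [B] of that line.
The hypothesis [brE] is the Pluecker relation, and [slope_at] is an affine
coordinate whose point at infinity is [R]. *)
Section Weights.
Variables (r beta : I -> F) (kappa : F) (br : I -> I -> F).
Hypothesis kappa0 : kappa != 0.
Hypothesis brE : forall Y W, kappa * br Y W = r Y * beta W - beta Y * r W.

Definition slope_at X := - beta X / r X.

Lemma prod_bracket T Y : {in T, forall W, r W != 0} -> Y \in T ->
  r Y ^+ 2 * \prod_(W in T :\ Y) br Y W =
  (kappa^-1 ^+ #|T|.-1 * \prod_(W in T) r W) * r Y ^+ #|T| * vdm T slope_at Y.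
Proof.
move=> rT YT; have cT : #|T :\ Y| = #|T|.-1 by rewrite [in RHS](cardsD1 Y) YT.
have -> : \prod_(W in T :\ Y) br Y W =
    \prod_(W in T :\ Y) (kappa^-1 * r Y * (r W * (slope_at Y - slope_at W))).
  apply: eq_bigr => W; rewrite !inE => /andP[_ WT].
  apply: (mulfI kappa0); rewrite brE /slope_at.
  by field; rewrite kappa0 !rT.
rewrite big_split /= prodr_const cT big_split /= exprMn -/(vdm T slope_at Y).
rewrite [X in _ = _ * X * _ * _](big_setD1 Y YT) /=.
have -> : r Y ^+ #|T| = r Y * r Y ^+ #|T|.-1.
  by rewrite -exprS prednK //; apply/card_gt0P; exists Y.
by ring.
Qed.

Lemma expr_card_odd (a : F) m : a ^+ (2 * #|F| + m) = a ^+ m.+2.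
Proof. by rewrite exprD mulnC exprM expf_card -exprD. Qed.

Lemma slope_at_inj S : {in S, forall W, r W != 0} ->
  {in S &, forall Y W, Y != W -> br Y W != 0} -> {in S &, injective slope_at}.
Proof.
move=> rS brS Y W YS WS e; apply/eqP/negPn/negP => YW.
have := brS Y W YS WS YW; suff -> : br Y W = 0 by rewrite eqxx.
apply: (mulfI kappa0); rewrite mulr0 brE.
have -> : r Y * beta W - beta Y * r W = r Y * r W * (slope_at Y - slope_at W).
  by rewrite /slope_at; field; rewrite !rS.
by rewrite e subrr mulr0.
Qed.

(** The square of Segre's product over the tangents, up to inversion, divided by a
Lagrange denominator over [J] and [R].  The cardinalities in the next two lemmas
make the degree in [Y] divisible by [q - 1], so that the weight depends only on
the point. *)
Definition weight S J Y : F :=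
  ((\prod_(W in S :\ Y) br Y W) ^+ 2 * r Y * \prod_(W in J :\ Y) br Y W)^-1.

(** When [R] is none of the points of [S], the interpolated polynomial has degree
two less than [#|J| - 1]. *)
Lemma sum_weight_tangent S J : J \subset S -> {in S, forall W, r W != 0} ->
  {in S &, forall Y W, Y != W -> br Y W != 0} ->
  (#|J| + 2 * #|S| = 2 * #|F| + 3)%N -> \sum_(Y in J) weight S J Y = 0.
Proof.
move=> JS rS brS JE; have yinj := slope_at_inj rS brS.
have rJ : {in J, forall W, r W != 0} by move=> W /(subsetP JS); apply: rS.
have Sq : (#|S| <= #|F|)%N by rewrite -(card_in_imset yinj); apply: max_card.
set C := (kappa^-1 ^+ #|S|.-1 * \prod_(W in S) r W) ^+ 2 *
         (kappa^-1 ^+ #|J|.-1 * \prod_(W in J) r W).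
have -> : \sum_(Y in J) weight S J Y =
    \sum_(Y in J) C^-1 * (vdm S slope_at Y ^+ 2 * vdm J slope_at Y)^-1.
  apply: eq_bigr => Y YJ; have YS := subsetP JS Y YJ.
  rewrite /weight -invfM; congr _^-1; have rY := rS Y YS.
  have rY5 : r Y ^+ 5 != 0 by rewrite expf_neq0.
  apply: (mulfI rY5); rewrite -[LHS]mulr1.
  transitivity ((r Y ^+ 2 * \prod_(W in S :\ Y) br Y W) ^+ 2 *
                (r Y ^+ 2 * \prod_(W in J :\ Y) br Y W)).
    by ring.
  rewrite !prod_bracket // -[RHS]mulr1 /C.
  have -> : r Y ^+ 5 = (r Y ^+ #|S|) ^+ 2 * r Y ^+ #|J|.
    by rewrite -(expr_card_odd (r Y) 3) -JE -exprM -exprD addnC mulnC.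
  by ring.
rewrite -mulr_sumr sum_inv_vdm //; last by lia.
by case: eqP => [E|_]; [lia | rewrite mulr0].
Qed.

(** When [R] is the point [W0] of [S], the degree is exactly [#|J| - 1] and the sum
is a nonzero multiple of the leading coefficient. *)
Lemma sum_weight_secant S J W0 : J \subset S :\ W0 -> W0 \in S ->
  r W0 = 0 -> {in S :\ W0, forall W, r W != 0} ->
  {in S &, forall Y W, Y != W -> br Y W != 0} ->
  (#|J| + 2 * #|S| = 2 * #|F| + 3)%N -> \sum_(Y in J) weight S J Y != 0.
Proof.
move=> JS W0S r0 rS brS JE.
have brS' : {in S :\ W0 &, forall Y W, Y != W -> br Y W != 0}.
  by move=> Y W /setD1P[_ ?] /setD1P[_ ?]; apply: brS.
have yinj := slope_at_inj rS brS'.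
have rJ : {in J, forall W, r W != 0} by move=> W /(subsetP JS); apply: rS.
have Sq : (#|S :\ W0| <= #|F|)%N by rewrite -(card_in_imset yinj); apply: max_card.
have S1 : #|S| = #|S :\ W0|.+1 by rewrite (cardsD1 W0) W0S.
have J0 : (0 < #|J|)%N by lia.
have JE' : (2 * #|F| + 1 = #|S :\ W0| * 2 + #|J|)%N by lia.
set C := (kappa^-1 * beta W0) ^+ 2 * 
         (kappa^-1 ^+ #|S :\ W0|.-1 * \prod_(W in S :\ W0) r W) ^+ 2 *
         (kappa^-1 ^+ #|J|.-1 * \prod_(W in J) r W).
have C0 : C != 0.
  have [Y YJ] := card_gt0P J0; have YS := subsetP JS Y YJ.
  have beta0 : beta W0 != 0.
    have [YW YS'] := setD1P YS; apply: contra (brS _ _ YS' W0S YW) => /eqP b0.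
    by apply/eqP/(mulfI kappa0); rewrite brE r0 b0 !mulr0 subrr.
  have kV : kappa^-1 != 0 by rewrite invr_eq0.
  have pS : \prod_(W in S :\ W0) r W != 0 by apply/prodf_neq0 => W; apply: rS.
  have pJ : \prod_(W in J) r W != 0 by apply/prodf_neq0 => W; apply: rJ.
  by rewrite /C !(mulf_neq0, expf_neq0).
have -> : \sum_(Y in J) weight S J Y =
    \sum_(Y in J) C^-1 * (vdm (S :\ W0) slope_at Y ^+ 2 * vdm J slope_at Y)^-1.
  apply: eq_bigr => Y YJ; have YS := subsetP JS Y YJ; have [YW YS'] := setD1P YS.
  rewrite /weight -invfM; congr _^-1; have rY := rS Y YS.
  have rY3 : r Y ^+ 3 != 0 by rewrite expf_neq0.
  apply: (mulfI rY3); rewrite -[LHS]mulr1.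
  have -> : \prod_(W in S :\ Y) br Y W =
      kappa^-1 * r Y * beta W0 * \prod_(W in (S :\ W0) :\ Y) br Y W.
    rewrite (big_setD1 W0) /=; last by rewrite !inE eq_sym YW.
    congr (_ * _); last by apply: eq_bigl => W; rewrite !inE andbCA.
    by apply: (mulfI kappa0); rewrite brE r0 mulr0 subr0 !mulrA divff // mul1r.
  transitivity ((kappa^-1 * beta W0) ^+ 2 *
                (r Y ^+ 2 * \prod_(W in (S :\ W0) :\ Y) br Y W) ^+ 2 *
                (r Y ^+ 2 * \prod_(W in J :\ Y) br Y W)).
    by ring.
  rewrite !prod_bracket // -[RHS]mulr1 /C.
  have -> : r Y ^+ 3 = (r Y ^+ #|S :\ W0|) ^+ 2 * r Y ^+ #|J|.
    by rewrite -(expr_card_odd (r Y) 1) -exprM -exprD JE'.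
  by ring.
rewrite -mulr_sumr sum_inv_vdm //; last by lia.
have -> : #|J| == (2 * (#|F| - #|S :\ W0|)).+1 by apply/eqP; lia.
by rewrite mulf_neq0 ?invr_eq0 ?oner_neq0.
Qed.

End Weights.

(** * Collinear extension points of a planar arc *)

Lemma segre_count (q k : nat) : (k <= q)%N ->
  ((2 * (q - k)).+1 + 2 * k.+1 = 2 * q + 3)%N.
Proof. lia. Qed.

Section Segre.
Variables (u v w : I -> F).

Definition bracket (c d e : I) : F :=
  u c * (v d * w e - v e * w d) - v c * (u d * w e - u e * w d)
  + w c * (u d * v e - u e * v d).

Lemma bracketC12 c d e : bracket d c e = - bracket c d e.
Proof. by rewrite /bracket; ring. Qed.

Lemma bracketC23 c d e : bracket c e d = - bracket c d e.
Proof. by rewrite /bracket; ring. Qed.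

Lemma bracket_pencil X R B Y W :
  bracket X R B * bracket X Y W =
  bracket X Y R * bracket X W B - bracket X Y B * bracket X W R.
Proof. by rewrite /bracket; ring. Qed.

(** [P] and [P'] extend an arc consisting of [K] and [R], and the three points are
collinear.  Over a subset [J0] of the arc containing [P], of cardinality
[2 (q - #|K|) + 2], consider the sum of the weights of all ordered pairs.  The
weight is antisymmetric, because it contains a square, the bracket with [R], and
an even number of further brackets; so the sum is zero in odd characteristic.  But
the row of each [X] in [K] vanishes, the line [X R] being tangent to
[K + P + P'], whereas the row of [P] does not, the line [P R] passing through
[P']. *)
Lemma segre (K : {set I}) (P P' R : I) : (2%:R : F) != 0 ->
  P \notin K -> P' \notin P |: K ->
  {in P |: (P' |: K) & &, forall X Y Z, X != Y -> X != Z -> Y != Z -> bracket X Y Z != 0} ->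
  {in K &, forall X Y, X != Y -> bracket X Y R != 0} ->
  {in K, forall X, bracket X P R != 0} -> {in K, forall X, bracket X P' R != 0} ->
  bracket P P' R = 0 ->
  (2 * #|F| + 1 <= 3 * #|K|)%N -> False.
Proof.
move=> two0 PK P'K arcK tanK tanP tanP' colR largeK.
have K_gt0 : (0 < #|K|)%N by lia.
set K1 := P |: (P' |: K) in arcK.
have PP' : P != P' by apply: contra P'K => /eqP<-; rewrite !inE eqxx.
have P'nK : P' \notin K by apply: contra P'K; rewrite inE => ->; rewrite orbT.
have cK1 : #|K1| = #|K|.+2.
  by rewrite !cardsU1 !inE (negPf PK) (negPf PP') (negPf P'nK).
(* twice the number of tangents at a point of K1, plus one *)
pose m := (2 * #|F| + 1 - 2 * #|K|)%N.
pose J := [set x in take m (enum K)].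
have JK : J \subset K by apply/subsetP => x; rewrite inE => /mem_take; rewrite mem_enum.
have mK : (m <= #|K|)%N by rewrite /m; lia.
have cJ : #|J| = m.
  have -> : #|J| = size (take m (enum K)).
    by rewrite cardsE; apply/card_uniqP; rewrite take_uniq // enum_uniq.
  by rewrite size_takel // -cardE.
have PJ : P \notin J by apply: contra PK; apply: (subsetP JK).
pose J0 := P |: J.
have cJ0 : #|J0| = m.+1 by rewrite cardsU1 PJ cJ.
have J0K1 : J0 \subset K1.
  by rewrite setUS // (subset_trans JK) // subsetUr.
have KK1 : K \subset K1 by rewrite /K1 setUA subsetUr.
have PK1 : P \in K1 by rewrite !inE eqxx.
have P'K1 : P' \in K1 by rewrite !inE eqxx orbT.
pose a X Y := weight (fun Y => bracket X Y R) (bracket X) (K1 :\ X) (J0 :\ X) Y.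
have tangent X Y : X \in K -> Y \in K1 :\ X -> bracket X Y R != 0.
  move=> XK; rewrite !inE => /andP[YX /or3P[/eqP->|/eqP->|YK]].
  - exact: tanP.
  - exact: tanP'.
  - by apply: tanK; rewrite // eq_sym.
have arc_at X : X \in K1 -> {in K1 :\ X &, forall Y W, Y != W -> bracket X Y W != 0}.
  by move=> XK1 Y W /setD1P[YX YK] /setD1P[WX WK] YW; apply: arcK; rewrite // eq_sym.
have K_le_F : (#|K| <= #|F|)%N.
  have [X XK] : exists X, X \in K by apply/card_gt0P.
  have XK1 := subsetP KK1 X XK; have PX : P != X by apply: contraNneq PK => ->.
  have k0 : bracket X R P != 0 by rewrite bracketC23 oppr_eq0 tanP.
  have yinj := slope_at_inj k0 (bracket_pencil X R P) (tangent X ^~ XK) (arc_at X XK1).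
  have : (#|K1 :\ X| <= #|F|)%N by rewrite -(card_in_imset yinj); apply: max_card.
  by move: cK1; rewrite (cardsD1 X) XK1 add1n => -[->]; apply: ltnW.
have m_odd : m = (2 * (#|F| - #|K|)).+1.
  by rewrite /m addn1 subSn ?leq_mul2l // mulnBr.
have mE : (m + 2 * #|K|.+1 = 2 * #|F| + 3)%N.
  by rewrite m_odd segre_count.
have cK1X X : X \in K1 -> #|K1 :\ X| = #|K|.+1.
  by move=> XK1; move: cK1; rewrite (cardsD1 X) XK1 add1n => -[].
have cJ0X X : X \in J0 -> #|J0 :\ X| = m.
  by move=> XJ0; move: cJ0; rewrite (cardsD1 X) XJ0 add1n => -[].
have numerics X : X \in J0 -> (#|J0 :\ X| + 2 * #|K1 :\ X| = 2 * #|F| + 3)%N.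
  by move=> XJ; rewrite cJ0X // cK1X ?(subsetP J0K1) // mE.
have sum_tangent X : X \in J -> \sum_(Y in J0 :\ X) a X Y = 0.
  move=> XJ; have XK := subsetP JK X XJ; have XK1 := subsetP KK1 X XK.
  have XJ0 : X \in J0 by rewrite inE XJ orbT.
  have k0 : bracket X R P != 0 by rewrite bracketC23 oppr_eq0 tanP.
  apply: (sum_weight_tangent k0 (bracket_pencil X R P)).
  - exact: setSD.
  - by move=> W; apply: tangent.
  - exact: arc_at.
  - exact: numerics.
have sum_secant : \sum_(Y in J0 :\ P) a P Y != 0.
  have PJ0 : P \in J0 by rewrite !inE eqxx.
  have [Z ZJ] : exists Z, Z \in J by apply/card_gt0P; rewrite cJ m_odd.
  have ZK := subsetP JK Z ZJ.
  have k0 : bracket P R Z != 0.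
    by rewrite bracketC23 bracketC12 opprK tanP.
  apply: (sum_weight_secant k0 (bracket_pencil P R Z) (W0 := P')) => //.
  - apply/subsetP => Y; rewrite in_setD1 in_setU1 => /andP[YP /orP[YP'|YJ]].
      by rewrite (negPf YP) in YP'.
    rewrite !inE YP (subsetP JK _ YJ) !orbT !andbT.
    by apply: contra P'nK => /eqP<-; apply: (subsetP JK).
  - by rewrite !inE eqxx eq_sym PP' orbT.
  - move=> Y; rewrite !inE => /and3P[YP' YP]; rewrite (negPf YP') (negPf YP) /=.
    by move=> YK; rewrite bracketC12 oppr_eq0 tanP.
  - exact: arc_at.
  - exact: numerics.
have swap T X Y : \prod_(W in T :\ Y :\ X) bracket Y X W =
    (-1) ^+ #|T :\ X :\ Y| * \prod_(W in T :\ X :\ Y) bracket X Y W.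
  rewrite -prodrN; have -> : T :\ Y :\ X = T :\ X :\ Y.
    by apply/setP => W; rewrite !inE andbCA.
  by apply: eq_bigr => W _; rewrite bracketC12.
have a_anti X Y : X \in J0 -> Y \in J0 :\ X -> a Y X = - a X Y.
  move=> XJ0 YJ; rewrite /a /weight (swap K1 X Y) (swap J0 X Y) -invrN; congr _^-1.
  have -> : #|J0 :\ X :\ Y| = (2 * (#|F| - #|K|))%N.
    apply/eqP; rewrite -eqSS -m_odd -(cJ0X X XJ0) [in X in _ == X](cardsD1 Y) YJ.
    by rewrite add1n.
  rewrite bracketC12 exprMn sqrr_sign mul1r exprM sqrrN !expr1n mul1r.
  by rewrite mulrN mulNr.
have total : \sum_(X in J0) \sum_(Y in J0 :\ X) a X Y = \sum_(Y in J0 :\ P) a P Y.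
  by rewrite /J0 big_setU1 //= -/J0 [X in _ + X]big1 ?addr0.
have : \sum_(X in J0) \sum_(Y in J0 :\ X) a X Y =
       - \sum_(X in J0) \sum_(Y in J0 :\ X) a X Y.
  rewrite {1}(exchange_big_dep (mem J0)) /=; last first.
    by move=> X Y _; rewrite inE => /andP[].
  rewrite -sumrN; apply: eq_bigr => Y YJ; rewrite -sumrN; apply: eq_big => X.
    by rewrite !in_setD1 YJ andbT eq_sym andbC.
  by move=> /andP[XJ YX]; rewrite (a_anti X Y) // opprK.
move/eqP; rewrite -subr_eq0 opprK -mulr2n -mulr_natl mulf_eq0 (negPf two0) /=.
by rewrite total (negPf sum_secant).
Qed.

End Segre.

End Pencil.

(** * Two linear columns that can be added separately *)

Section Compatibility.
Local Open Scope ring_scope.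
Variables (F : finFieldType) (n : nat).
Implicit Types (x y z : 'rV[F]_n) (c P : 'cV[F]_n) (S : {set 'cV[F]_n}).
Implicit Types (W Z : {vspace 'rV[F]_n}).

(** [P] can be appended to [S].  The zero of [P] is counted separately, which forces
[P] outside [S]. *)
Definition extends W S k P :=
  forall x, x \in W -> x != 0 -> (zeros S x + (ev x P == 0%R) <= k)%N.

Lemma extends_arc0 W S k P : extends W S k P -> arc_on W S k.
Proof. by move=> eP x xW x0; apply: leq_trans (leq_addr _ _) (eP x xW x0). Qed.

Lemma dim_extends W S k P : \dim W = k.+1 -> (k <= #|S|)%N -> extends W S k P ->
  \dim (W :&: kernel P) = k.
Proof.
move=> dW kS eP; apply/eqP; rewrite eqn_leq; apply/andP; split; last first.
  by have := dim_cap_kernel W P; rewrite dW.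
rewrite leqNgt; apply/negP => dk; have [z [zW z0 kz]] := many_zeros dk kS.
move: zW; rewrite memv_cap mem_kernel => /andP[zW zP].
by have := eP z zW z0; rewrite zP addn1 ltnNge kz.
Qed.

Lemma extends_notin W S k P : \dim W = k.+2 -> (k < #|S|)%N -> extends W S k.+1 P ->
  P \notin S.
Proof.
move=> dW kS eP; apply/negP => PS.
have dk : (k < \dim (W :&: kernel P))%N by have := dim_cap_kernel W P; rewrite dW.
have kS' : (k <= #|S :\ P|)%N by rewrite -ltnS -card_setD1.
have [z [zW z0 kz]] := many_zeros dk kS'.
move: zW; rewrite memv_cap mem_kernel => /andP[zW zP].
have := eP z zW z0; rewrite zP addn1 (zeros_setD1 PS (eqP zP)).
by rewrite ltnS ltnNge kz.
Qed.

Lemma zerosU1 S P x : P \notin S -> zeros (P |: S) x = ((ev x P == 0%R) + zeros S x)%N.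
Proof.
move=> PS; rewrite /zeros (cardsD1 P) !inE eqxx /=; congr (_ + _)%N.
apply: eq_card => c; rewrite !inE; case: eqVneq => //= ->.
by rewrite (negPf PS).
Qed.

Lemma extends_arc W S k P : P \notin S -> extends W S k P -> arc_on W (P |: S) k.
Proof. by move=> PS eP x xW x0; rewrite zerosU1 // addnC; apply: eP. Qed.

Lemma extends_slice W S k c P : extends W S k.+1 P -> c \in S ->
  extends (W :&: kernel c) (S :\ c) k P.
Proof.
move=> eP cS x; rewrite memv_cap mem_kernel => /andP[xW /eqP xc] x0.
by have := eP _ xW x0; rewrite (zeros_setD1 cS xc).
Qed.

(** If the bracket vanished, the cross product of [c] and [d] would be a word killed
by [c], [d] and [e], hence zero; but some words separate [c] from [d]. *)
Lemma bracket_neq0 W T (e0 e1 e2 : 'rV[F]_n) c d e : \dim W = 3 -> arc_on W T 2 ->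
  e0 \in W -> e1 \in W -> e2 \in W ->
  (forall t0 t1 t2, t0 *: e0 + t1 *: e1 + t2 *: e2 = 0 -> [/\ t0 = 0, t1 = 0 & t2 = 0]) ->
  (forall x, x \in W -> exists t0 t1 t2, x = t0 *: e0 + t1 *: e1 + t2 *: e2) ->
  c \in T -> d \in T -> e \in T -> c != d -> c != e -> d != e ->
  bracket (ev e0) (ev e1) (ev e2) c d e != 0.
Proof.
move=> dW aW e0W e1W e2W free span cT dT eT cd ce de; apply/negP => /eqP b0.
pose n0 := ev e1 c * ev e2 d - ev e1 d * ev e2 c.
pose n1 := ev e2 c * ev e0 d - ev e2 d * ev e0 c.
pose n2 := ev e0 c * ev e1 d - ev e0 d * ev e1 c.
have nE a : ev (n0 *: e0 + n1 *: e1 + n2 *: e2) a = bracket (ev e0) (ev e1) (ev e2) c d a.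
  by rewrite !evD !evZ /bracket /n0 /n1 /n2; ring.
have cdeT : {subset [:: c; d; e] <= T} by move=> a; rewrite !inE => /or3P[] /eqP->.
have ucde : uniq [:: c; d; e] by rewrite /= !inE negb_or cd ce de.
have [n00 n10 n20] : [/\ n0 = 0, n1 = 0 & n2 = 0].
  apply: free; apply: (arc_eq0 aW ucde cdeT) => //; first by rewrite !memvD ?memvZ.
  move=> a; rewrite !inE nE => /or3P[] /eqP->; rewrite ?b0 // /bracket; ring.
have [f [fW fc fd]] : exists f, [/\ f \in W, ev f c = 1 & ev f d = 0].
  have [f [fW fc fde]] := dual_vector aW dW ucde cdeT erefl.
  by exists f; split=> //; apply: fde; rewrite !inE eqxx.
have [f' [f'W f'd f'c]] : exists f, [/\ f \in W, ev f d = 1 & ev f c = 0].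
  have udce : uniq [:: d; c; e] by rewrite /= !inE negb_or de ce eq_sym cd.
  have dceT : {subset [:: d; c; e] <= T} by move=> a; rewrite !inE => /or3P[] /eqP->.
  have [f' [f'W f'd f'ce]] := dual_vector aW dW udce dceT erefl.
  by exists f'; split=> //; apply: f'ce; rewrite !inE eqxx.
have [s0 [s1 [s2 fE]]] := span f fW; have [t0 [t1 [t2 f'E]]] := span f' f'W.
(* Lagrange's identity for the cross products of c, d and of f, f' *)
have : ev f c * ev f' d - ev f d * ev f' c =
    (s1 * t2 - s2 * t1) * n0 + (s2 * t0 - s0 * t2) * n1 + (s0 * t1 - s1 * t0) * n2.
  by rewrite fE f'E !evD !evZ /n0 /n1 /n2; ring.
rewrite n00 n10 n20 fc fd f'd f'c mul0r subr0 mulr1 !mulr0 !addr0 => /eqP.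
by rewrite oner_eq0.
Qed.

Variable B : nat.
Hypotheses (B_gt0 : (0 < B)%N) (B_small : (3 * B <= #|F|)%N).
Hypothesis two_neq0 : (2%:R : F) != 0.

(** The word [x] obstructs adding both [P] and [P'] to [S]; then the kernel of [P]
on [W] is contained in that of [P'], and equal to it by symmetry. *)
Definition compatible_at k := forall W S P P' x y, \dim W = k.+1 ->
  (#|F| + k <= #|S| + B)%N -> extends W S k P -> extends W S k P' ->
  x \in W -> x != 0 -> ev x P = 0 -> ev x P' = 0 -> (k <= (zeros S x).+1)%N ->
  y \in W -> ev y P = 0 -> ev y P' = 0.

Lemma compatible1 : compatible_at 1.
Proof.
move=> W S P P' x y dW SB eP eP' xW x0 xP xP' _ yW yP.
have kS := large_card B_gt0 B_small SB.
have dP : \dim (W :&: kernel P) = 1%N by apply: dim_extends eP; rewrite // ltnW // ltnW.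
have xWP : x \in (W :&: kernel P)%VS by rewrite memv_cap xW mem_kernel xP eqxx.
have /eqP WP : <[x]>%VS == (W :&: kernel P)%VS.
  by rewrite eqEdim -memvE xWP dP dim_vline x0.
have : y \in (W :&: kernel P)%VS by rewrite memv_cap yW mem_kernel yP eqxx.
by rewrite -WP => /vlineP[t ->]; rewrite evZ xP' mulr0.
Qed.

(** The word [x] is killed by [P], [P'] and some [R] in [S].  In the basis dual to
[P], [R] and a further [X] this reads [P' = alp P + gam R], with [gam] nonzero if
the kernels differ, and [segre] applies. *)
Lemma compatible2 : compatible_at 2.
Proof.
move=> W S P P' x y dW SB eP eP' xW x0 xP xP' xS yW yP.
have kS := large_card B_gt0 B_small SB.
have PS := extends_notin dW (ltnW (ltnW kS)) eP.
have P'S := extends_notin dW (ltnW (ltnW kS)) eP'.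
have aT := extends_arc PS eP; have aT' := extends_arc P'S eP'.
have [R] : exists R, R \in [set c in S | ev x c == 0] by apply/card_gt0P.
rewrite inE => /andP[RS /eqP xR].
apply/eqP/negPn/negP => yP'.
have PP' : P' != P by apply: contraNneq yP' => ->; rewrite yP.
have PR : P != R by apply: contraNneq PS => ->.
have P'R : P' != R by apply: contraNneq P'S => ->.
have cSR := card_setD1 RS.
have largeK : (2 * #|F| + 1 <= 3 * #|S :\ R|)%N.
  have aux q s : (q + 2 <= s.+1 + B -> 3 * B <= q -> 2 * q + 1 <= 3 * s)%N.
    by clear; lia.
  by apply: aux B_small; rewrite -cSR.
have [X XK] : exists X, X \in S :\ R.
  by apply/card_gt0P; rewrite -ltnS -cSR ltnW // ltnW.
have [XR XS] := setD1P XK; have PX : P != X by apply: contraNneq PS => ->.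
have dual a b c : a \in P |: S -> b \in P |: S -> c \in P |: S ->
    uniq [:: a; b; c] -> exists e, [/\ e \in W, ev e a = 1, ev e b = 0 & ev e c = 0].
  move=> aS bS cS u; have sS : {subset [:: a; b; c] <= P |: S}.
    by move=> d; rewrite !inE => /or3P[] /eqP->; rewrite -?in_setU1.
  have [e [eW ea e0]] := dual_vector aT dW u sS erefl.
  by exists e; split=> //; apply: e0; rewrite !inE eqxx ?orbT.
have PT : P \in P |: S by rewrite setU11.
have RT : R \in P |: S by rewrite setU1r.
have XT : X \in P |: S by rewrite setU1r.
have RX : R != X by rewrite eq_sym.
have [e0 [e0W e0P e0R e0X]] : exists e, [/\ e \in W, ev e P = 1, ev e R = 0 & ev e X = 0].
  by apply: dual; rewrite //= !inE negb_or PR PX RX.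
have [e1 [e1W e1R e1P e1X]] : exists e, [/\ e \in W, ev e R = 1, ev e P = 0 & ev e X = 0].
  by apply: dual; rewrite //= !inE negb_or eq_sym PR PX RX.
have [e2 [e2W e2X e2P e2R]] : exists e, [/\ e \in W, ev e X = 1, ev e P = 0 & ev e R = 0].
  by apply: dual; rewrite //= !inE negb_or eq_sym PX PR XR.
have decomp z : z \in W -> z = ev z P *: e0 + ev z R *: e1 + ev z X *: e2.
  move=> zW; apply/eqP; rewrite -subr_eq0; apply/eqP.
  apply: (arc_eq0 (s := [:: P; R; X]) aT) => //=.
  - by rewrite !inE negb_or PR PX RX.
  - by move=> d; rewrite !inE => /or3P[] /eqP->; rewrite -?in_setU1.
  - by rewrite memvB ?memvD ?memvZ.
  - move=> d; rewrite !inE evB !evD !evZ => /or3P[] /eqP->.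
    + by rewrite e0P e1P e2P; ring.
    + by rewrite e0R e1R e2R; ring.
    + by rewrite e0X e1X e2X; ring.
have e2P' : ev e2 P' = 0.
  have xE := decomp x xW; rewrite xP xR !scale0r !add0r in xE.
  move: xP'; rewrite xE evZ => /eqP; rewrite mulf_eq0 => /orP[/eqP xX|/eqP//].
  by rewrite xE xX scale0r eqxx in x0.
pose gam := ev e1 P'; pose alp := ev e0 P'.
have gam0 : gam != 0.
  apply: contra yP' => /eqP g0; rewrite (decomp y yW) !evD !evZ yP e2P' -/gam g0.
  by rewrite !mulr0 mul0r !addr0.
have free t0 t1 t2 : t0 *: e0 + t1 *: e1 + t2 *: e2 = 0 -> [/\ t0 = 0, t1 = 0 & t2 = 0].
  move=> E; split.
  - have := congr1 (fun z => ev z P) E.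
    by rewrite /= !evD !evZ ev0 e0P e1P e2P mulr1 !mulr0 !addr0.
  - have := congr1 (fun z => ev z R) E.
    by rewrite /= !evD !evZ ev0 e0R e1R e2R mulr1 !mulr0 addr0 add0r.
  - have := congr1 (fun z => ev z X) E.
    by rewrite /= !evD !evZ ev0 e0X e1X e2X mulr1 !mulr0 !add0r.
have span z : z \in W -> exists t0 t1 t2, z = t0 *: e0 + t1 *: e1 + t2 *: e2.
  by move=> /decomp->; do 3!eexists.
pose br := bracket (ev e0) (ev e1) (ev e2).
have nzT c d e : c \in P |: S -> d \in P |: S -> e \in P |: S ->
    c != d -> c != e -> d != e -> br c d e != 0 by apply: (bracket_neq0 dW aT).
have nzT' c d e : c \in P' |: S -> d \in P' |: S -> e \in P' |: S ->
    c != d -> c != e -> d != e -> br c d e != 0 by apply: (bracket_neq0 dW aT').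
have brPP' a : br P P' a = gam * br P R a.
  rewrite /br /bracket -/alp -/gam e2P' e0P e1P e2P e0R e1R e2R; ring.
have sw12 c d e : br d c e != 0 -> br c d e != 0 by rewrite /br bracketC12 oppr_eq0.
have sw23 c d e : br c e d != 0 -> br c d e != 0 by rewrite /br bracketC23 oppr_eq0.
have nzPP' a : a \in P |: (P' |: S :\ R) -> a != P -> a != P' -> br P P' a != 0.
  rewrite !inE => /or3P[/eqP->|/eqP->|/andP[ZR ZS] ZP _]; rewrite ?eqxx // brPP'.
  rewrite mulf_neq0 //; apply: (nzT P R a PT RT _ PR).
  - by rewrite setU1r.
  - by rewrite eq_sym.
  - by rewrite eq_sym.
apply: (@segre _ _ (ev e0) (ev e1) (ev e2) (S :\ R) P P' R) => //.
- by rewrite !inE (negPf PS) andbF.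
- by rewrite !inE (negPf PP') (negPf P'S) andbF.
- have inT a : a \in P |: (P' |: S :\ R) -> a != P' -> a \in P |: S.
    by rewrite !inE => /or3P[->//|->//|/andP[_ ->]]; rewrite orbT.
  have inT' a : a \in P |: (P' |: S :\ R) -> a != P -> a \in P' |: S.
    by rewrite !inE => /or3P[->//|->//|/andP[_ ->]]; rewrite orbT.
  move=> c d e cK dK eK cd ce de; rewrite -/(br c d e).
  have [cE|cP'] := eqVneq c P'.
    subst c; have [dE|dP] := eqVneq d P.
      by subst d; apply/sw12/nzPP' => //; rewrite eq_sym.
    have [eE|eP0] := eqVneq e P.
      by subst e; apply/sw23/sw12/nzPP' => //; rewrite eq_sym.
    by apply: nzT' => //; apply: inT'.
  have [dE|dP'] := eqVneq d P'.
    subst d; have [cE|cP] := eqVneq c P.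
      by subst c; apply/nzPP' => //; rewrite eq_sym.
    have [eE|eP0] := eqVneq e P.
      by subst e; apply/sw12/sw23/sw12/nzPP'.
    by apply: nzT' => //; apply: inT'.
  have [eE|eP'0] := eqVneq e P'.
    subst e; have [cE|cP] := eqVneq c P.
      by subst c; apply/sw23/nzPP' => //; rewrite eq_sym.
    have [dE|dP] := eqVneq d P.
      by subst d; apply/sw12/sw23/nzPP'.
    by apply: nzT' => //; apply: inT'.
  by apply: nzT => //; apply: inT.
- move=> c d /setD1P[cR cS] /setD1P[dR dS] cd.
  by apply: nzT; rewrite ?setU1r.
- move=> c /setD1P[cR cS]; apply: nzT; rewrite ?PT ?setU1r //.
  by apply: contraNneq PS => <-.
- move=> c /setD1P[cR cS]; apply: nzT'; rewrite ?setU11 ?setU1r //.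
  by apply: contraNneq P'S => <-.
- by rewrite -/(br P P' R) brPP' /br /bracket; ring.
Qed.

(** Slicing by two functionals [c1], [c2] that kill [x] shows that the kernels of [P]
and [P'] coincide there.  If they differed on [W], their intersection would be
killed by [P], [c1] and [c2], and contain words with too many zeros. *)
Lemma compatible_step m : compatible_at m.+2 -> compatible_at m.+3.
Proof.
move=> IH W S P P' x y dW SB eP eP' xW x0 xP xP' xS yW yP.
have kS := large_card B_gt0 B_small SB.
have [c1 [c2 [c1x c2x c12]]] : exists c1 c2,
    [/\ c1 \in [set c in S | ev x c == 0], c2 \in [set c in S | ev x c == 0] & c1 != c2].
  by apply/card_gt1P; apply: leq_trans (_ : m.+2 <= _)%N.
apply/eqP/negPn/negP => yP'.
have slice c : c \in [set c in S | ev x c == 0] ->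
    forall z, z \in W -> ev z c = 0 -> ev z P = 0 -> ev z P' = 0.
  rewrite inE => /andP[cS /eqP xc] z zW zc zP.
  have xWc : x \in (W :&: kernel c)%VS by rewrite memv_cap xW mem_kernel xc eqxx.
  have zWc : z \in (W :&: kernel c)%VS by rewrite memv_cap zW mem_kernel zc eqxx.
  have dWc := dim_slice (extends_arc0 eP) dW cS (ltnW kS).
  have SBc : (#|F| + m.+2 <= #|S :\ c| + B)%N.
    by move: SB; rewrite (card_setD1 cS) addnS addSn.
  have xSc : (m.+2 <= (zeros (S :\ c) x).+1)%N by move: xS; rewrite (zeros_setD1 cS xc).
  exact: (IH _ _ _ _ x z dWc SBc (extends_slice eP cS) (extends_slice eP' cS)).
pose H := (W :&: kernel P)%VS; pose Z := (H :&: kernel P')%VS.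
have dH : \dim H = m.+3 by apply: dim_extends eP; rewrite // ltnW // ltnW.
have yH : y \in H by rewrite memv_cap yW mem_kernel yP eqxx.
have yZ : y \notin Z by rewrite memv_cap yH mem_kernel.
have dZ : (\dim Z <= m.+2)%N.
  rewrite -ltnS -(dim_add_vector yZ) -dH; apply: dimvS.
  by rewrite subv_add capvSl -memvE yH.
have Zc c : c \in [set c in S | ev x c == 0] -> (Z <= kernel c)%VS.
  move=> cx; suff /eqP<- : (H :&: kernel c)%VS == Z by apply: capvSr.
  rewrite eqEdim; apply/andP; split; last first.
    by apply: leq_trans dZ _; have := dim_cap_kernel H c; rewrite dH.
  apply/subvP => z; rewrite /Z !memv_cap !mem_kernel => /andP[/andP[zW /eqP zP] /eqP zc].
  by rewrite zW zP eqxx (slice c cx z) ?eqxx.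
have dZ' : (m.+1 < \dim Z)%N by have := dim_cap_kernel H P'; rewrite dH.
move: (c1x) (c2x); rewrite !inE => /andP[c1S _] /andP[c2S _].
have c2S' : c2 \in S :\ c1 by rewrite !inE eq_sym c12.
have mS : (m.+1 <= #|S :\ c1 :\ c2|)%N.
  by rewrite -ltnS -card_setD1 // -ltnS -card_setD1 // ltnW // ltnW.
have [z [zZ z0 kz]] := many_zeros dZ' mS.
have /eqP z1 : ev z c1 == 0 by rewrite -mem_kernel; apply: subvP (Zc _ c1x) z zZ.
have /eqP z2 : ev z c2 == 0 by rewrite -mem_kernel; apply: subvP (Zc _ c2x) z zZ.
move: zZ; rewrite !memv_cap !mem_kernel => /andP[/andP[zW zP] _].
have := eP z zW z0; rewrite zP addn1 (zeros_setD1 c1S z1) (zeros_setD1 c2S' z2).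
by rewrite !ltnS leqNgt kz.
Qed.

Theorem compatible k : compatible_at k.+1.
Proof.
elim: k => [|[|k] IH]; [exact: compatible1|exact: compatible2|exact: compatible_step].
Qed.

End Compatibility.

(** * Codes whose columns have the same level sets *)

Section Equivalence.
Local Open Scope ring_scope.
Variables (A T : finType).

(** Adding the points one by one: composing with the transposition that corrects
the value at the new point leaves the earlier values unchanged. *)
Lemma extend_to_perm (X : {set T}) (a b : T -> A) :
  {in X &, forall x y, (a x == a y) = (b x == b y)} ->
  exists s : {perm A}, {in X, forall x, s (b x) = a x}.
Proof.
move=> ab; suff [s sP] : exists s : {perm A},
    forall x, x \in enum X -> s (b x) = a x.
  by exists s => x xX; apply: sP; rewrite mem_enum.
have: {subset enum X <= X} by move=> x; rewrite mem_enum.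
elim: (enum X) => [|x l IHl] lX; first by exists 1%g.
have [y yl|s sP] := IHl; first by apply: lX; rewrite inE yl orbT.
exists (s * tperm (s (b x)) (a x))%g => y; rewrite inE permM.
case/predU1P=> [->|yl]; first by rewrite tpermL.
have yX : y \in X by apply: lX; rewrite inE yl orbT.
have xX : x \in X by apply: lX; rewrite mem_head.
rewrite (sP y yl); case: tpermP => // e.
  have /perm_inj/eqP : s (b y) = s (b x) by rewrite sP.
  by rewrite -ab // => /eqP.
by move/eqP: e; rewrite ab // => /eqP <-; apply: sP.
Qed.

Lemma equivalent_trans (C D E : code A) :
  equivalent C D -> equivalent D E -> equivalent C E.
Proof.
by elim=> [//|n B s D' _ IH /IH|n B j s D' _ IH /IH];
  [apply: equivalent_col_perm | apply: equivalent_relabel].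
Qed.

Definition relabel_seq n (s : 'I_n -> {perm A}) (l : seq 'I_n) (w : 'rV[A]_n) :
  'rV[A]_n := \row_j (if j \in l then s j (w ord0 j) else w ord0 j).

Lemma equivalent_relabel_seq n (B : {set 'rV[A]_n}) (s : 'I_n -> {perm A}) l :
  uniq l -> equivalent (Code B) (Code [set relabel_seq s l w | w in B]).
Proof.
elim: l B => [|i l IHl] B /=.
  move=> _; have -> : [set relabel_seq s [::] w | w in B] = B.
    rewrite -[RHS]imset_id; apply: eq_imset => w.
    by apply/rowP => j; rewrite mxE.
  exact: equivalent_refl.
case/andP=> il ul; apply: (@equivalent_relabel _ _ _ i (s i)).
apply: equivalent_trans (IHl _ ul) _; rewrite -imset_comp.
have -> : [set relabel_seq s (i :: l) w | w in B] =
          [set (relabel_seq s l \o relabel i (s i)) w | w in B].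
  apply: eq_imset => w; apply/rowP => j; rewrite !mxE inE.
  by have [->|ji] := eqVneq j i; rewrite ?(negPf il).
exact: equivalent_refl.
Qed.

(** Up to equivalence, a code depends only on the partitions of its words induced by
its columns. *)
Lemma equivalent_columns (n : nat) (X : {set T}) (phi psi : T -> 'rV[A]_n) (s : 'S_n) :
  (forall j, {in X &, forall x y,
     (phi x ord0 j == phi y ord0 j) = (psi x ord0 (s j) == psi y ord0 (s j))}) ->
  equivalent (Code [set psi x | x in X]) (Code [set phi x | x in X]).
Proof.
move=> same.
have [tau tauP] : exists tau : 'I_n -> {perm A},
    forall j, {in X, forall x, tau j (psi x ord0 (s j)) = phi x ord0 j}.
  pose R j (t : {perm A}) := {in X, forall x, t (psi x ord0 (s j)) = phi x ord0 j}.
  apply: (@fin_all_exists _ (fun=> {perm A}) R) => j.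
  exact: extend_to_perm (same j).
apply: (@equivalent_col_perm _ _ _ s).
apply: equivalent_trans (equivalent_relabel_seq _ tau (enum_uniq 'I_n)) _.
rewrite -!imset_comp.
have -> : [set phi x | x in X] =
          [set (relabel_seq tau (enum 'I_n) \o (col_perm s \o psi)) x | x in X].
  apply: eq_in_imset => x xX; apply/rowP => j; rewrite /= mxE mem_enum inE.
  by rewrite mxE tauP.
exact: equivalent_refl.
Qed.

End Equivalence.

(** * Codes presented by functionals *)

Section Codes.
Local Open Scope ring_scope.
Variables (F : finFieldType) (n k B : nat) (U : {vspace 'rV[F]_n}).
Implicit Types (x y z : 'rV[F]_n) (P Q : 'cV[F]_n).

Definition unit_col (i : 'I_n) : 'cV[F]_n := delta_mx i ord0.

Lemma ev_unit_col x i : ev x (unit_col i) = x ord0 i.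
Proof.
by rewrite /ev -colE mxE.
Qed.

Lemma unit_col_inj : injective unit_col.
Proof.
move=> i j /matrixP/(_ i ord0); rewrite !mxE !eqxx andbT.
by case: eqP => // _ /eqP; rewrite oner_eq0.
Qed.

Definition coords : {set 'cV[F]_n} := [set unit_col i | i : 'I_n].

Lemma card_coords : #|coords| = n.
Proof. by rewrite card_imset ?card_ord //; apply: unit_col_inj. Qed.

Lemma zeros_imset (I : finType) (u : I -> 'cV[F]_n) (J : {set I}) x :
  {in J &, injective u} -> zeros (u @: J) x = #|[set i in J | ev x (u i) == 0]|.
Proof.
move=> u_inj; rewrite /zeros -(card_in_imset (f := u)) => [|i i']; last first.
  by rewrite !inE => /andP[iJ _] /andP[i'J _]; apply: u_inj.
apply: eq_card => P; rewrite inE; apply/andP/imsetP => [[/imsetP[i iJ ->] xi]|[i]].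
  by exists i; rewrite ?inE ?iJ.
by rewrite inE => /andP[iJ xi] ->; rewrite imset_f.
Qed.

Lemma coordsE : coords = unit_col @: setT.
Proof. by apply/setP => P; apply/imsetP/imsetP => -[i _ ->]; exists i. Qed.

Lemma zeros_coords x : zeros coords x = #|[set i | x ord0 i == 0]|.
Proof.
rewrite coordsE zeros_imset => [|i j _ _]; last exact: unit_col_inj.
by apply: eq_card => i; rewrite !inE ev_unit_col.
Qed.

(** Project onto a line complementary to [H], then read off a coordinate that does
not vanish on this line. *)
Lemma hyperplane_functional H : (H <= U)%VS -> (\dim U = (\dim H).+1)%N ->
  exists c, {in U, forall x, (x \in H) = (ev x c == 0)}.
Proof.
move=> HU dU.
have [w wU wH] : exists2 w, w \in U & w \notin H.
  by apply/subvPn; apply/negP => /dimvS; rewrite dU ltnn.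
have /eqP UE : (H + <[w]>)%VS == U.
  by rewrite eqEdim subv_add HU -memvE wU dim_add_vector // dU /=.
have w0 : w != 0 by apply: contraNneq wH => ->; rewrite mem0v.
have [i wi] : exists i, w ord0 i != 0.
  apply/existsP; apply: contraR w0; rewrite negb_exists => /forallP w0.
  by apply/eqP/rowP => i; rewrite mxE; apply/eqP; rewrite -[_ == _]negbK.
have dis : (<[w]> :&: H)%VS = 0%VS.
  apply/eqP; rewrite -subv0; apply/subvP => x; rewrite memv_cap memv0.
  case/andP=> /vlineP[t ->] tw; have [->|t0] := eqVneq t 0; first by rewrite scale0r.
  by case/negP: wH; rewrite -[w](scalerK t0) memvZ.
pose pi := daddv_pi <[w]> H.
exists (col i (lin1_mx pi)) => x; rewrite -{1}UE => /memv_addP[z zH [y yw xE]].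
have -> : ev x (col i (lin1_mx pi)) = pi x ord0 i.
  rewrite -[in RHS](mul_rV_lin1 pi) /ev !mxE; apply: eq_bigr => j _.
  by rewrite [col _ _ _ _]mxE.
have xWH : x \in (<[w]> + H)%VS.
  by rewrite xE addrC memv_add.
have piE := daddv_pi_add dis xWH; rewrite -/pi in piE.
have pH : daddv_pi H <[w]> x \in H by apply: memv_pi.
have -> : (x \in H) = (pi x \in H) by rewrite -[in LHS]piE rpredDr.
have /vlineP[t ->] : pi x \in <[w]>%VS by apply: memv_pi.
rewrite mxE mulf_eq0 (negPf wi) orbF.
apply/idP/eqP => [twH|->]; last by rewrite scale0r mem0v.
apply/eqP; apply: contraNT wH => t0.
by rewrite -[w](scalerK t0) memvZ.
Qed.

Hypotheses (dimU : \dim U = k.+2) (arcU : arc_on U coords k.+1).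
Hypotheses (B_gt0 : (0 < B)%N) (B_small : (3 * B <= #|F|)%N).
Hypothesis large : (#|F| + k.+1 <= n + B)%N.
Hypothesis two_neq0 : (2%:R : F) != 0.
Hypothesis affine_of_few_slopes : forall f : F -> F, (#|slopes f| <= B)%N ->
  exists a, forall u, f u = f 0 + u * a.

Lemma large_coords : (#|F| + k.+1 <= #|coords| + B)%N.
Proof. by rewrite card_coords. Qed.

Lemma large_n : (k.+2 < n)%N.
Proof. by have := large_card B_gt0 B_small large_coords; rewrite card_coords. Qed.

Definition same_kernel P Q :=
  [forall x, (x \in U) ==> ((ev x P == 0) == (ev x Q == 0))].

Lemma same_kernelP P Q :
  reflect {in U, forall x, (ev x P == 0) = (ev x Q == 0)} (same_kernel P Q).
Proof.
apply: (iffP forallP) => [PQ x xU|PQ x]; last by apply/implyP => /PQ ->.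
by have := PQ x; rewrite xU => /eqP.
Qed.

Definition good P := [forall x, (x \in U) && (x != 0) ==>
  (zeros coords x + (ev x P == 0%R) <= k.+1)%N].

Lemma goodP P : reflect (extends U coords k.+1 P) (good P).
Proof.
apply: (iffP forallP) => [gP x xU x0|gP x]; first by have := gP x; rewrite xU x0.
by apply/implyP => /andP[]; apply: gP.
Qed.

(** A column of [W] may be nonlinear, so it is compared with a functional only
through its level sets, the words being parametrized by [U].  The functionals
themselves form an arc, which makes [W] an MDS code. *)
Definition represents m (W : {set 'rV[F]_m}) (phi : 'rV[F]_n -> 'rV[F]_m)
    (c : 'I_m -> 'cV[F]_n) :=
  [/\ W = [set phi x | x in U],
      forall j, {in U &, forall x y,
        (phi x ord0 j == phi y ord0 j) = (ev (x - y) (c j) == 0)} &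
      forall x, x \in U -> x != 0 -> (#|[set j | ev x (c j) == 0%R]| <= k.+1)%N].

Lemma represents_inj m (W : {set 'rV[F]_m}) phi c : represents W phi c ->
  (k.+1 < m)%N -> {in U &, injective phi}.
Proof.
move=> [_ same arcc] km x y xU yU e; apply/eqP; rewrite -subr_eq0.
apply: contraTT km => xy; rewrite -leqNgt.
apply: leq_trans (arcc _ (memvB xU yU) xy).
rewrite -[X in (X <= _)%N]card_ord -cardsT subset_leq_card //.
by apply/subsetP => j _; rewrite inE -same // e.
Qed.

Lemma represents_mds m (W : {set 'rV[F]_m}) phi c : represents W phi c ->
  (k.+1 < m)%N -> is_mds k.+2 (Code W).
Proof.
move=> rW km; have phi_inj := represents_inj rW km; case: rW => WE same arcc.
split=> /=; first by rewrite WE card_in_imset // card_vspace dimU.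
move=> u v; rewrite WE => /imsetP[x xU ->] /imsetP[y yU ->] xy.
have xy' : x - y != 0 by rewrite subr_eq0; apply: contra_notN xy => /eqP->.
rewrite ltnS; apply: leq_trans (arcc _ (memvB xU yU) xy').
by apply/subset_leq_card/subsetP => j; rewrite !inE same.
Qed.

Lemma column_functional g : new_column U coords k.+1 g ->
  exists c, {in U &, forall x y, (g x == g y) = (ev (x - y) c == 0)}.
Proof.
move=> gU.
have [H [HU dH] perH] :=
  all_columns_periodic affine_of_few_slopes B_gt0 B_small two_neq0 dimU arcU gU large_coords.
have [|c cE] := hyperplane_functional HU; first by rewrite dH.
exists c => x y xU yU; rewrite -cE; last exact: memvB.
have xE : y + (x - y) = x by rewrite addrC subrK.
apply/eqP/idP => [gxy|xyH]; last by rewrite -(perH _ xyH y yU) xE.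
have kS := large_card B_gt0 B_small large_coords.
apply: (period_sub dimU (ltnW (ltnW kS)) gU HU dH perH yU); rewrite ?memvB //.
by rewrite xE.
Qed.

(** Deleting coordinates is injective on the words of an extension, as both codes
have the same size; the inverse gives [phi]. *)
Lemma represents_extension m (W : {set 'rV[F]_m}) (f : 'I_n -> 'I_m) :
  is_mds k.+2 (Code W) -> injective f ->
  [set w | w \in U] = [set colsub f w | w in W] ->
  exists phi c, [/\ represents W phi c, forall i, c (f i) = unit_col i &
                    {in U, forall x, colsub f (phi x) = x}].
Proof.
move=> [/= cardW distW] f_inj UW.
have f_injW : {in W &, injective (colsub f : 'rV[F]_m -> 'rV[F]_n)}.
  apply/imset_injP; rewrite -UW cardW -dimU -card_vspace; apply/eqP.
  by apply: eq_card => x; rewrite inE.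
pose phi x : 'rV[F]_m := odflt 0 [pick w in W | colsub f w == x].
have phiP x : x \in U -> phi x \in W /\ colsub f (phi x) = x.
  move=> xU; rewrite /phi; case: pickP => [w /andP[wW /eqP]//|none].
  have : x \in [set colsub f w | w in W] by rewrite -UW inE.
  by case/imsetP=> w wW xE; have := none w; rewrite wW xE eqxx.
have phi_coord x i : x \in U -> phi x ord0 (f i) = x ord0 i.
  by case/phiP=> _ xE; rewrite -{2}xE mxE.
have WE : W = [set phi x | x in U].
  apply/setP => w; apply/idP/imsetP => [wW|[x xU ->]]; last by case: (phiP x xU).
  have wU : colsub f w \in U.
    by have := imset_f (colsub f) wW; rewrite -UW inE.
  exists (colsub f w) => //; have [phW phE] := phiP _ wU.
  exact: f_injW.
have phi_dist x y : x \in U -> y \in U -> x != y ->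
    (#|[set j | phi x ord0 j == phi y ord0 j]| <= k.+1)%N.
  move=> xU yU xy; have [xW xE] := phiP x xU; have [yW yE] := phiP y yU.
  by apply: distW => // e; move: xy; rewrite -xE -yE e eqxx.
pose R j c := (forall i, f i = j -> c = unit_col i) /\
  {in U &, forall x y, (phi x ord0 j == phi y ord0 j) = (ev (x - y) c == 0)}.
have [c cP] : exists c : 'I_m -> 'cV[F]_n, forall j, R j (c j).
  apply: (@fin_all_exists _ (fun=> 'cV[F]_n) R) => j.
  have [/existsP[i /eqP fi]|nf] := boolP [exists i, f i == j].
    exists (unit_col i); split=> [i' fi'|x y xU yU].
      by congr unit_col; apply: f_inj; rewrite fi'.
    by rewrite -fi !phi_coord // ev_unit_col !mxE subr_eq0.
  have fj i : f i != j by move: nf; rewrite negb_exists => /forallP.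
  have [|c cE] := @column_functional (fun x => phi x ord0 j).
    move=> x y xU yU xy gxy; rewrite zeros_coords.
    have := phi_dist x y xU yU xy; rewrite (cardsD1 j) inE gxy eqxx add1n.
    move=> le_k; apply: leq_trans le_k; rewrite ltnS -(card_imset _ f_inj).
    apply/subset_leq_card/subsetP => _ /imsetP[i xyi ->].
    by move: xyi; rewrite !inE fj !phi_coord // !mxE subr_eq0.
  by exists c; split=> // i fi; have := fj i; rewrite fi eqxx.
exists phi, c; split=> [|i|x xU]; last by case: (phiP x xU).
  split=> // [j|x xU x0]; first by case: (cP j).
  have le_k := phi_dist x 0 xU (mem0v U) x0; apply: leq_trans le_k.
  apply/subset_leq_card/subsetP => j; rewrite !inE.
  by have [_ ->] := cP j; rewrite ?mem0v // subr0.
by have [+ _] := cP (f i); apply.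
Qed.

(** Furthermore the columns at the positions [f i] are the coordinates of [U]: the
code [W] is [U] itself or one of its extensions. *)
Definition presented m (W : {set 'rV[F]_m}) phi c (f : 'I_n -> 'I_m) :=
  [/\ represents W phi c, forall i j : 'I_n, (i < j)%N -> (f i < f j)%N,
      forall i, c (f i) = unit_col i & {in U, forall x, colsub f (phi x) = x}].

Section Presented.
Variables (m : nat) (W : {set 'rV[F]_m}) (phi : 'rV[F]_n -> 'rV[F]_m).
Variables (c : 'I_m -> 'cV[F]_n) (f : 'I_n -> 'I_m).
Hypothesis pW : presented W phi c f.

Lemma presented_f_inj : injective f.
Proof.
move=> i j; case: pW => _ mono _ _; case: (ltngtP i j) => [|ji|/val_inj//].
  by move/mono => lt_f e; rewrite e ltnn in lt_f.
by move/mono: ji => lt_f e; rewrite e ltnn in lt_f.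
Qed.

Lemma presented_size : (n <= m)%N.
Proof. by have := leq_card f presented_f_inj; rewrite !card_ord. Qed.

Lemma presented_large : (k.+1 < m)%N.
Proof. exact: leq_trans (ltnW large_n) presented_size. Qed.

Lemma presented_mds : is_mds k.+2 (Code W).
Proof. by case: pW => rW _ _ _; apply: represents_mds rW presented_large. Qed.

Lemma presented_words : [set w | w \in U] = [set colsub f w | w in W].
Proof.
case: pW => -[-> _ _] _ _ cf; rewrite -imset_comp; apply/setP => x.
rewrite inE; apply/idP/imsetP => [xU|[y yU ->]]; last by rewrite /= cf.
by exists x; rewrite //= cf.
Qed.

Lemma columns_arc x : x \in U -> x != 0 -> (#|[set j | ev x (c j) == 0%R]| <= k.+1)%N.
Proof. by case: pW => -[_ _ arcc] _ _ _; apply: arcc. Qed.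

Lemma column_unit i : c (f i) = unit_col i.
Proof. by case: pW. Qed.

(** Two columns with the same kernel could be killed together with [k] further
ones. *)
Lemma same_kernel_inj j j' : same_kernel (c j) (c j') -> j = j'.
Proof.
move/same_kernelP => same; apply/eqP/negPn/negP => jj'.
pose I0 := [set i | f i \notin [set j; j']].
pose T := [set unit_col i | i in I0].
have cT : (k <= #|T|)%N.
  rewrite (card_imset _ unit_col_inj).
  have cC : (#|~: I0| <= 2)%N.
    rewrite -(card_imset _ presented_f_inj).
    apply: leq_trans (_ : #|[set j; j']| <= 2)%N; last by rewrite cards2 jj'.
    apply/subset_leq_card/subsetP => _ /imsetP[i iI0 ->].
    by move: iI0; rewrite 2!in_set negbK.
  have := cardsC I0; rewrite card_ord => cI.
  rewrite -(leq_add2r 2) addn2; apply: leq_trans (ltnW large_n) _.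
  by apply: leq_trans (eq_leq (esym cI)) _; rewrite leq_add2l.
have dZ : (k < \dim (U :&: kernel (c j)))%N by have := dim_cap_kernel U (c j); rewrite dimU.
have [z [zZ z0 kz]] := many_zeros dZ cT.
move: zZ; rewrite memv_cap mem_kernel => /andP[zU zj].
have := columns_arc zU z0; rewrite (cardsD1 j) inE zj (cardsD1 j') !inE eq_sym jj'.
rewrite -same // zj !add1n ltnS ltnNge; case/negP.
apply: leq_trans kz _; rewrite zeros_imset => [|i i' _ _]; last exact: unit_col_inj.
rewrite -(card_imset _ presented_f_inj); apply/subset_leq_card/subsetP => _ /imsetP[i + ->].
by rewrite !inE column_unit negb_or => /andP[/andP[fj fj'] ->]; rewrite fj fj'.
Qed.

Lemma columns_inj : injective c.
Proof. by move=> j j' e; apply: same_kernel_inj; apply/same_kernelP => x _; rewrite e. Qed.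

Lemma zeros_columns (J : {set 'I_m}) x :
  zeros (c @: J) x = #|[set j in J | ev x (c j) == 0]|.
Proof. by apply: zeros_imset => j j' _ _; apply: columns_inj. Qed.

Lemma column_extends (J : {set 'I_m}) j : j \notin J -> extends U (c @: J) k.+1 (c j).
Proof.
move=> jJ x xU x0; apply: leq_trans (columns_arc xU x0); rewrite zeros_columns.
rewrite [X in (_ <= X)%N](cardsD1 j) inE addnC leq_add2l.
apply/subset_leq_card/subsetP => i; rewrite !inE => /andP[iJ ->]; rewrite andbT.
by apply: contraNneq jJ => <-.
Qed.

Lemma coords_columns : coords = c @: (f @: setT).
Proof.
rewrite -imset_comp coordsE; apply: eq_imset => i.
by rewrite /= column_unit.
Qed.

Lemma column_good j : (forall i, f i != j) -> good (c j).
Proof.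
move=> fj; apply/goodP; rewrite coords_columns; apply: column_extends.
by apply/imsetP => -[i _ e]; have := fj i; rewrite e eqxx.
Qed.

(** The columns of the code are appended one at a time to the coordinates, and
[compatible] applies at each step. *)
Lemma good_extends P : good P -> (forall j, ~~ same_kernel P (c j)) ->
  extends U (c @: setT) k.+1 P.
Proof.
move=> /goodP gP nP.
have ext (l : seq 'I_m) : extends U (c @: ((f @: setT) :|: [set j in l])) k.+1 P.
  elim: l => [|j l IHl].
    have -> : [set j in [::]] = set0 :> {set 'I_m} by apply/setP => j; rewrite !inE.
    by rewrite setU0 -coords_columns.
  set J := (f @: setT) :|: [set j in l] in IHl.
  have -> : (f @: setT) :|: [set i in j :: l] = j |: J.
    by apply/setP => i; rewrite !inE orbCA.
  have [jJ|jJ] := boolP (j \in J).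
    by have -> : j |: J = J by apply/setUidPr; rewrite sub1set.
  have eJ := column_extends jJ; rewrite imsetU1 => x xU x0.
  have cJ : c j \notin c @: J.
    by apply/imsetP => -[i iJ /columns_inj ji]; rewrite ji iJ in jJ.
  rewrite zerosU1 //; have := IHl x xU x0; have := eJ x xU x0.
  have largeJ : (#|F| + k.+1 <= #|c @: J| + B)%N.
    apply: leq_trans large_coords _; rewrite leq_add2r coords_columns.
    by rewrite subset_leq_card // imsetS // subsetUl.
  have [xj|_] := boolP (ev x (c j) == 0); last by rewrite add0n.
  have [xP|_ le1 _] := boolP (ev x P == 0); last by rewrite addn0 addnC.
  move=> _ _; have [lt_k|kz] := ltnP (zeros (c @: J) x).+1 k.+1.
    by rewrite add1n addn1.
  case/negP: (nP j); apply/same_kernelP => y yU.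
  have comp := compatible B_gt0 B_small two_neq0.
  apply/eqP/eqP => y0.
    exact: (comp n k U _ P (c j) x y dimU largeJ IHl eJ xU x0 (eqP xP) (eqP xj) kz yU y0).
  exact: (comp n k U _ (c j) P x y dimU largeJ eJ IHl xU x0 (eqP xj) (eqP xP) kz yU y0).
have -> : [set: 'I_m] = (f @: setT) :|: [set j in enum 'I_m]; last exact: ext.
by apply/setP => j; rewrite !inE mem_enum orbT.
Qed.

Definition extend_word P x : 'rV[F]_(m + 1) := row_mx (phi x) (ev x P)%:M.

Definition extend_columns P (j : 'I_(m + 1)) : 'cV[F]_n :=
  match split j with inl i => c i | inr _ => P end.

Lemma presented_add P : good P -> (forall j, ~~ same_kernel P (c j)) ->
  presented [set extend_word P x | x in U] (extend_word P) (extend_columns P)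
    (lshift 1 \o f).
Proof.
move=> gP nP; have eP := good_extends gP nP.
have extl x (j : 'I_m) : extend_word P x ord0 (lshift 1 j) = phi x ord0 j.
  by rewrite row_mxEl.
case: pW => -[_ same _] mono cf phf; split=> [|i j /mono//|i|x xU].
- split=> // [j x y xU yU|x xU x0].
    rewrite /extend_columns -[j]splitK; case: (split j) => i; rewrite unsplitK /=.
      by rewrite !extl same.
    by rewrite !row_mxEr !mxE [i]ord1 eqxx !mulr1n evB subr_eq0.
  apply: leq_trans (eP x xU x0); rewrite zeros_columns.
  rewrite -!sum1_card big_mkcond big_split_ord /= big_ord1 leq_add //.
    rewrite [X in (_ <= X)%N]big_mkcond leq_sum // => j _.
    by rewrite !inE /extend_columns (unsplitK (inl _ j)).
  by rewrite inE /extend_columns (unsplitK (inr _ ord0)); case: eqP.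
- by rewrite /extend_columns (unsplitK (inl _ (f i))).
- by apply/rowP => i; rewrite mxE /= extl -[in RHS](phf x xU) mxE.
Qed.

End Presented.

(** * Maximal extensions *)

Let C : code F := Code [set w | w \in U].

Lemma C_presented : presented (words C) id unit_col id.
Proof.
split=> // [|x _]; last by apply/rowP => j; rewrite mxE.
split=> [|j x y _ _|x xU x0].
- apply/setP => x; rewrite inE; apply/idP/imsetP => [xU|[y yU ->//]].
  by exists x.
- by rewrite ev_unit_col !mxE subr_eq0.
- apply: leq_trans (arcU xU x0); rewrite zeros_coords; apply: eq_leq.
  by apply: eq_card => i; rewrite !inE ev_unit_col.
Qed.

Lemma extension_presented m (W : {set 'rV[F]_m}) (f : 'I_n -> 'I_m) :
  is_mds k.+2 (Code W) -> (forall i j : 'I_n, (i < j)%N -> (f i < f j)%N) ->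
  words C = [set colsub f w | w in W] -> exists phi c, presented W phi c f.
Proof.
move=> mdsW mono WE; have f_inj : injective f.
  move=> i j; case: (ltngtP i j) => [/mono lt_f e|/mono lt_f e|/val_inj//];
    by rewrite e ltnn in lt_f.
have [phi [c [rW cf phf]]] := represents_extension mdsW f_inj WE.
by exists phi, c.
Qed.

Lemma member_presented (D : code F) : self_or_extension k.+2 C D ->
  exists phi c f, presented (words D) phi c f.
Proof.
case=> [->|[_ mdsD _ [f [mono WE]]]]; first by exists id, unit_col, id; apply: C_presented.
case: D mdsD f mono WE => m W mdsD f mono WE.
by have [phi [c pW]] := extension_presented mdsD mono WE; exists phi, c, f.
Qed.

Lemma presented_member m (W : {set 'rV[F]_m}) phi c f : presented W phi c f ->
  (n < m)%N -> is_extension k.+2 C (Code W).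
Proof.
move=> pW nm; split=> //; first exact: presented_mds C_presented.
  exact: presented_mds pW.
by exists f; split; [case: pW | exact: presented_words pW].
Qed.

Definition full m (c : 'I_m -> 'cV[F]_n) :=
  [forall P, good P ==> [exists j, same_kernel P (c j)]].

Lemma full_columns m m' (W : {set 'rV[F]_m}) (W' : {set 'rV[F]_m'}) phi phi' c c' f f' :
  presented W phi c f -> presented W' phi' c' f' -> full c' ->
  exists2 g : 'I_m -> 'I_m', injective g & forall j, same_kernel (c j) (c' (g j)).
Proof.
move=> pW pW' /forallP full'.
have [g gP] : exists g : 'I_m -> 'I_m', forall j, same_kernel (c j) (c' (g j)).
  apply: (@fin_all_exists _ (fun=> 'I_m') (fun j j' => same_kernel (c j) (c' j'))) => j.
  have [/existsP[i /eqP <-]|nf] := boolP [exists i, f i == j].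
    exists (f' i); rewrite (column_unit pW) (column_unit pW').
    by apply/same_kernelP.
  have gj : good (c j).
    by apply: (column_good pW) => i; move: nf; rewrite negb_exists => /forallP.
  by have := full' (c j); rewrite gj => /existsP.
exists g => // i j gij; apply: (same_kernel_inj pW).
apply/same_kernelP => x xU; have /same_kernelP -> // := gP i.
by have /same_kernelP -> // := gP j; rewrite gij.
Qed.

(** Each column of an extension has the same kernel as a column of [W], so there
cannot be more of them. *)
Lemma full_maximal m (W : {set 'rV[F]_m}) phi c f : presented W phi c f -> full c ->
  is_maximal k.+2 (Code W).
Proof.
move=> pW fullW; split=> [|[m' W'] [_ mdsW' /= mm' [g [gmono WE]]]].
  exact: presented_mds pW.
have [||phi' [c' pW']] := @extension_presented m' W' (g \o f) mdsW'.
- by move=> i j ij; apply: gmono; case: pW => _ mono _ _; apply: mono.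
- rewrite /= (presented_words pW) WE -imset_comp; apply: eq_imset => w.
  by apply/rowP => j; rewrite !mxE.
have [h h_inj _] := full_columns pW' pW fullW.
by have := leq_card h h_inj; rewrite !card_ord leqNgt mm'.
Qed.

Lemma nonfull_extends m (W : {set 'rV[F]_m}) phi c f : presented W phi c f ->
  ~~ full c -> exists W' : {set 'rV[F]_(m + 1)}, exists phi' c' f',
    presented W' phi' c' f' /\ is_extension k.+2 (Code W) (Code W').
Proof.
move=> pW; rewrite negb_forall => /existsP[P].
rewrite negb_imply negb_exists => /andP[gP /forallP nP].
have pW' := presented_add pW gP nP.
do 4!eexists; split; first exact: pW'.
split=> /=; [exact: presented_mds pW|exact: presented_mds pW'|by rewrite addn1|].
exists (lshift 1); split=> [i j //|].
rewrite -imset_comp; case: pW => -[-> _ _] _ _ _.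
by apply: eq_imset => x; apply/rowP => j; rewrite mxE row_mxEl.
Qed.

(** Columns are added as long as possible; they are pairwise distinct elements of a
finite type. *)
Lemma exists_full : exists D : code F, self_or_extension k.+2 C D /\
  exists phi c f, presented (words D) phi c f /\ full c.
Proof.
have climb N : forall D : code F, (#|{: 'cV[F]_n}| <= len D + N)%N ->
    self_or_extension k.+2 C D -> exists M : code F, self_or_extension k.+2 C M /\
    exists phi c f, presented (words M) phi c f /\ full c.
  elim: N => [|N IHN] [m W] /= mN DS; have [phi [c [f pW]]] := member_presented DS;
    (have [fullc|nfull] := boolP (full c);
       first by exists (Code W); split=> //; exists phi, c, f);
    have [W' [phi' [c' [f' [pW' _]]]]] := nonfull_extends pW nfull.
    have := leq_card c' (columns_inj pW'); rewrite card_ord addn1 => /leq_trans/(_ mN).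
    by rewrite addn0 ltnn.
  apply: (IHN (Code W')) => /=; first by rewrite addn1 addSnnS.
  right; apply: presented_member pW' _.
  by rewrite addn1 ltnS; apply: presented_size pW.
by apply: (climb #|{: 'cV[F]_n}| C); [exact: leq_addl | left].
Qed.

Lemma maximal_full m (W : {set 'rV[F]_m}) phi c f : presented W phi c f ->
  is_maximal k.+2 (Code W) -> full c.
Proof.
move=> pW [_ noext]; apply/negPn/negP => nfull.
have [W' [_ [_ [_ [_ eW']]]]] := nonfull_extends pW nfull.
exact: noext eW'.
Qed.

Lemma imset_vspace m (psi : 'rV[F]_n -> 'rV[F]_m) :
  [set psi x | x in U] = [set psi x | x in [set w | w \in U]].
Proof.
apply/setP => w; apply/imsetP/imsetP => -[x xU ->]; exists x => //.
  by rewrite inE.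
by rewrite inE in xU.
Qed.

Lemma full_equivalent m m' (W : {set 'rV[F]_m}) (W' : {set 'rV[F]_m'}) phi phi' c c' f f' :
  presented W phi c f -> presented W' phi' c' f' -> full c -> full c' ->
  equivalent (Code W') (Code W).
Proof.
move=> pW pW' fullc fullc'.
have [g g_inj gP] := full_columns pW pW' fullc'.
have [g' g'_inj _] := full_columns pW' pW fullc.
have /eqP mm' : m == m'.
  have := leq_card g g_inj; have := leq_card g' g'_inj; rewrite !card_ord.
  by rewrite eqn_leq => -> ->.
subst m'; have [[-> same _] _ _ _] := pW; have [[-> same' _] _ _ _] := pW'.
rewrite !imset_vspace; apply: (@equivalent_columns _ _ _ _ phi phi' (perm g_inj)) => j x y.
rewrite !inE => xU yU; rewrite permE same // same' //.
by have /same_kernelP -> := gP j; last exact: memvB.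
Qed.

Lemma presented_LE m (W : {set 'rV[F]_m}) phi c f : presented W phi c f ->
  is_LE k.+2 (Code W).
Proof.
move=> pW; pose G : 'M[F]_(n, m) := \matrix_(i, j) c j i ord0.
have GE x j : (x *m G) ord0 j = ev x (c j).
  by rewrite /ev !mxE; apply: eq_bigr => i _; rewrite mxE.
have [[WE same _] _ _ _] := pW.
pose l := linfun (mulmxr G : 'rV[F]_n -> 'rV[F]_m).
have lE x : l x = x *m G by rewrite lfunE.
exists (Code [set x *m G | x in U]).
  exists (l @: U)%VS => /=.
    rewrite limg_dim_eq ?dimU //; apply/eqP; rewrite -subv0; apply/subvP => x.
    rewrite memv_cap memv_ker memv0 lE => /andP[xU /eqP xG].
    apply: contraTT (presented_large pW) => x0; rewrite -leqNgt.
    apply: leq_trans (columns_arc pW xU x0).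
    rewrite -[X in (X <= _)%N]card_ord -cardsT subset_leq_card //.
    by apply/subsetP => j _; rewrite inE -GE xG mxE.
  apply/setP => w; rewrite inE; apply/imsetP/memv_imgP => -[x xU ->];
    by exists x; rewrite ?lE.
rewrite WE !imset_vspace; apply: (@equivalent_columns _ _ _ _ _ phi 1%g) => j x y.
by rewrite !inE => xU yU; rewrite perm1 same // !GE evB subr_eq0.
Qed.

End Codes.

Theorem theorem7p14 (p h t k : nat) (F : finFieldType) (C : code F)
    (p_prime : prime p) (q_eq : #|F| = (p ^ h)%N) (q_odd : odd #|F|)
    (t_max : largest_proper_divisor t h)
    (k_gt0 : 0 < k)
    (C_mds : is_mds k.+1 C) (C_linear : is_linear k.+1 C)
    (pt_gt3 : 3 < p ^ t)
    (n_large : #|F| - p ^ (h - t) + k - 1 < len C) :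
  (forall D : code F, self_or_extension k.+1 C D -> is_LE k.+1 D) /\
  (exists M : code F,
     [/\ self_or_extension k.+1 C M, is_maximal k.+1 M &
         forall M' : code F, self_or_extension k.+1 C M' ->
           is_maximal k.+1 M' -> equivalent M' M]).
Proof.
case: k k_gt0 C_mds C_linear n_large => // k _ C_mds [U dimU wordsC] n_large.
case: C C_mds U dimU wordsC n_large => n W /= C_mds U dimU WE n_large.
move: WE C_mds => -> {W} C_mds.
have [t_dvd t_lt t_maxi] := t_max.
have p_gt0 := prime_gt0 p_prime.
have h_gt0 : 0 < h by case: (h) t_lt.
have p_gt2 : 2 < p.
  rewrite odd_prime_gt2 //; move: q_odd.
  by rewrite q_eq oddX => /orP[/eqP h0|//]; rewrite h0 in h_gt0.
have B_gt0 : 0 < p ^ (h - t) by rewrite expn_gt0 p_gt0.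
have qE : #|F| = p ^ t * p ^ (h - t) by rewrite q_eq -expnD subnKC // ltnW.
have B_small : 3 * p ^ (h - t) <= #|F| by rewrite qE leq_mul2r ltnW ?orbT.
have large : #|F| + k.+1 <= n + p ^ (h - t).
  by move: n_large; rewrite addnS subn1 /= => n_large; rewrite -leq_subLR; lia.
have two_neq0 : (2%:R : F)%R != 0%R.
  rewrite -(dvdn_pcharf (card_finPcharP q_eq p_prime)).
  by apply/negP => /dvdn_leq -/(_ isT); rewrite leqNgt p_gt2.
have few := few_slopes_affine p_prime q_eq p_gt2 t_dvd t_lt t_maxi.
have arcU : arc_on U (coords F n) k.+1.
  move=> x xU x0; rewrite zeros_coords; have [_ dist] := C_mds.
  have := dist x 0%R; rewrite !inE mem0v xU => /(_ isT isT (elimN eqP x0)).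
  rewrite ltnS; apply: leq_trans; apply: eq_leq; apply: eq_card => i.
  by rewrite !inE mxE.
pose pres D := @member_presented F n k _ U dimU arcU B_gt0 B_small large two_neq0 few D.
split=> [[m W] /pres[phi [c [f pW]]]|].
  exact: (presented_LE dimU B_gt0 B_small large pW).
have [[m W] [MS [phi [c [f [pW fullW]]]]]] :=
  exists_full dimU arcU B_gt0 B_small large two_neq0 few.
exists (Code W); split=> //.
  exact: (full_maximal dimU arcU B_gt0 B_small large two_neq0 few pW fullW).
move=> [m' W'] /pres[phi' [c' [f' pW']]] maxW'.
have fullW' := maximal_full dimU B_gt0 B_small large two_neq0 pW' maxW'.
exact: (full_equivalent dimU B_gt0 B_small large pW pW' fullW fullW').
Qed.
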